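(* Let $\widehat{H}$ be a path-separable signed graph. If $\widehat{H}$ is a segmented signed graph, then $\widehat{H}$ has a special bipartite min ordering, and $\textsc{List-S-Hom}(\widehat{H})$ is polynomial-time solvable.
   Context: A signed graph $\widehat{H}$ consists of a vertex set $V(H)$ and two symmetric binary relations on it: positive (blue) edges and negative (red) edges. Its underlying graph $H$ has vertex set $V(H)$ and edge set the union of the two relations. A blue edge and a red edge with the same endpoints together form a bicoloured edge; an edge not part of such a pair is unicoloured. If $uv$ is bicoloured (resp. unicoloured), $v$ is a bicoloured (resp. unicoloured) neighbour of $u$. The signed graph is irreflexive if it has no loops. Switching at a vertex $v$ changes the sign of every non-loop edge incident with $v$; two signed graphs are switching equivalent if one can be obtained from the other by a sequence of switchings. A sign-preserving homomorphism $\widehat{G}\to\widehat{H}$ is a map $f:V(G)\to V(H)$ such that for every blue (resp. red) edge $xy$ of $\widehat{G}$, $f(x)f(y)$ is a blue (resp. red) edge of $\widehat{H}$ (possibly one of the two edges of a bicoloured edge). A homomorphism $\widehat{G}\to\widehat{H}$ is a map $f$ such that there is a signed graph $\widehat{G}'$ switching equivalent to $\widehat{G}$ for which $f$ is a sign-preserving homomorphism $\widehat{G}'\to\widehat{H}$. For a fixed $\widehat{H}$, $\textsc{List-S-Hom}(\widehat{H})$ takes as input a signed graph $\widehat{G}$ with lists $L(v)\subseteq V(H)$, $v\in V(G)$, and asks whether there is a homomorphism $f:\widehat{G}\to\widehat{H}$ with $f(v)\in L(v)$ for all $v$. For a bipartite graph $H$ with parts of black and white vertices, a min ordering is a pair $(<_b,<_w)$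 of linear orders on the black vertices and on the white vertices such that for white $x<_w x'$ and black $y<_b y'$, if $xy'$ and $x'y$ are edges then $xy$ is an edge. A special (bipartite) min ordering of an irreflexive signed graph $\widehat{H}$ with bipartite underlying graph is a min ordering of $H$ in which, for each vertex, all its bicoloured neighbours precede all its unicoloured neighbours. An irreflexive signed graph $\widehat{H}$ is path-separable if its unicoloured edges form a spanning path $P=v_1v_2\ldots v_n$ of $H$ (so every other edge is bicoloured). A segment is a maximal subpath $v_iv_{i+1}\ldots v_{i+2j+1}$ of $P$ with $j\ge 1$ such that $v_{i+e}v_{i+e+3}$ is bicoloured for every even $e$, $0\le e\le 2j-2$. It is right-leaning if $v_{i+e}v_{i+e+o}$ is bicoloured for every even $e$, $0\le e\le 2j-2$, and every odd $o\ge3$ with $i+e+o\le n$; left-leaning if $v_{i+2j+1-e}v_{i+2j+1-e-o}$ is bicoloured for every even $e$, $0\le e\le 2j-2$, and every odd $o\ge 3$ with $i+2j+1-e-o\ge1$. $\widehat{H}$ is right-segmented if all segments are right-leaning and there are no edges besides those of $P$ and the bicoloured edges so required; left-segmented symmetrically. $\widehat{H}$ is left-right-segmented if there is a unique segment $v_i\ldots v_{i+2j+1}$ that is both left- and right-leaning, all earlier segments are left-leaning, all later ones right-leaning, additionally $v_{i-e}v_{i+2j+o}$ is bicoloured for all even $e\ge2$ and odd $o\ge3$ (indices in range), and there are no other edges than those of $P$ and those so required. $\widehat{H}$ is segmented if it is right-, left-, or left-right-segmented (a path with no bicoloured edges counts as segmented).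
   Formalization: Segments are additionally required to be pairwise edge-disjoint on the path; without this the claim is false: the path v1…v5 with bicoloured v1v4 and v2v5 is literally right-segmented, but v2 forces v5<v1 and v4 forces v1<v5. *)

(* Defs.v *)
From mathcomp Require Import all_boot all_order all_algebra.

Set Implicit Arguments.
Unset Strict Implicit.
Unset Printing Implicit Defensive.

(** * Signed graphs and homomorphisms *)

Record signed_graph (V : finType) := SignedGraph {
  blue : rel V;
  red : rel V;
  blue_sym : symmetric blue;
  red_sym : symmetric red }.

Section SignedGraph.
Variables (V : finType) (G : signed_graph V).

Definition edge : rel V := fun x y => blue G x y || red G x y.
Definition bicoloured : rel V := fun x y => blue G x y && red G x y.
Definition unicoloured : rel V := fun x y => edge x y && ~~ bicoloured x y.

Definition irreflexive_sg : Prop := forall x, ~~ edge x x.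

Definition flipped (v : V) : rel V :=
  fun x y => (x != y) && ((x == v) || (y == v)).

Lemma flipped_sym (v : V) : symmetric (flipped v).
Proof. by move=> x y; rewrite /flipped eq_sym orbC. Qed.

Definition switch_blue (v : V) : rel V :=
  fun x y => if flipped v x y then red G x y else blue G x y.
Definition switch_red (v : V) : rel V :=
  fun x y => if flipped v x y then blue G x y else red G x y.

Lemma switch_blue_sym (v : V) : symmetric (switch_blue v).
Proof.
by move=> x y; rewrite /switch_blue flipped_sym (blue_sym G x) (red_sym G x).
Qed.

Lemma switch_red_sym (v : V) : symmetric (switch_red v).
Proof.
by move=> x y; rewrite /switch_red flipped_sym (blue_sym G x) (red_sym G x).
Qed.

Definition switch (v : V) : signed_graph V :=
  SignedGraph (switch_blue_sym v) (switch_red_sym v).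

End SignedGraph.

Definition switching_equivalent (V : finType) (G G' : signed_graph V) : Prop :=
  exists s : seq V, G' = foldl (@switch V) G s.

Definition sign_preserving_hom (V W : finType) (G : signed_graph V)
    (H : signed_graph W) (f : V -> W) : Prop :=
  (forall x y, blue G x y -> blue H (f x) (f y)) /\
  (forall x y, red G x y -> red H (f x) (f y)).

Definition sg_hom (V W : finType) (G : signed_graph V) (H : signed_graph W)
    (f : V -> W) : Prop :=
  exists G', switching_equivalent G G' /\ sign_preserving_hom G' H f.

(** * Special bipartite min orderings *)

Definition linear_order_on (V : finType) (A : {set V}) (lt : rel V) : Prop :=
  [/\ {in A, irreflexive lt}, {in A & &, transitive lt}
    & {in A &, forall x y, x != y -> lt x y || lt y x}].

Section MinOrdering.
Variables (V : finType) (H : signed_graph V).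
(* [B] is the set of black vertices; the white vertices are [~: B]. *)
Variables (B : {set V}) (ltb ltw : rel V).

Definition bipartition : Prop :=
  forall x y, edge H x y -> (x \in B) != (y \in B).

Definition bipartite_min_ordering : Prop :=
  [/\ bipartition, linear_order_on B ltb, linear_order_on (~: B) ltw
    & forall x x' y y', x \in ~: B -> x' \in ~: B -> y \in B -> y' \in B ->
        ltw x x' -> ltb y y' -> edge H x y' -> edge H x' y -> edge H x y].

(* The neighbours of a black vertex are white, and conversely. *)
Definition special_min_ordering : Prop :=
  [/\ bipartite_min_ordering,
      forall x u w, x \in B -> bicoloured H x u -> unicoloured H x w -> ltw u w
    & forall x u w, x \in ~: B ->
        bicoloured H x u -> unicoloured H x w -> ltb u w].

End MinOrdering.

Definition has_special_bipartite_min_ordering (V : finType)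
    (H : signed_graph V) : Prop :=
  irreflexive_sg H /\
  exists (B : {set V}) (ltb ltw : rel V), special_min_ordering H B ltb ltw.

(** * Path-separable and segmented signed graphs *)

Section PathSeparable.
Variables (V : finType) (H : signed_graph V).
(* The path is v 1, v 2, ..., v n with n = #|V|; the values of [v] outside
   1..n are irrelevant. *)
Variable v : nat -> V.
Local Notation n := #|V|.

Definition unicoloured_spanning_path : Prop :=
  [/\ forall i k, 0 < i <= n -> 0 < k <= n -> v i = v k -> i = k,
      forall x, exists2 i, 0 < i <= n & x = v i
    & forall x y, unicoloured H x y <->
        exists2 i, 0 < i < n &
          (x = v i /\ y = v i.+1) \/ (x = v i.+1 /\ y = v i)].

(* The pair (i, j) stands for the subpath v_i ... v_(i+2j+1). *)
Definition presegment (i j : nat) : Prop :=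
  [/\ 0 < i, 0 < j, i + 2 * j + 1 <= n
    & forall e, ~~ odd e -> e <= 2 * j - 2 ->
        bicoloured H (v (i + e)) (v (i + e + 3))].

Definition segment (i j : nat) : Prop :=
  presegment i j /\
  forall i' j', presegment i' j' ->
    i' <= i -> i + 2 * j + 1 <= i' + 2 * j' + 1 -> i' = i /\ j' = j.

Definition right_pair (i j a b : nat) : Prop :=
  exists e o, [/\ ~~ odd e, e <= 2 * j - 2, odd o & 3 <= o] /\
    [/\ i + e + o <= n, a = i + e & b = i + e + o].

Definition left_pair (i j a b : nat) : Prop :=
  exists e o, [/\ ~~ odd e, e <= 2 * j - 2, odd o & 3 <= o] /\
    [/\ 1 <= i + 2 * j + 1 - e - o, a = i + 2 * j + 1 - e
      & b = i + 2 * j + 1 - e - o].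

Definition cross_pair (i j a b : nat) : Prop :=
  exists e o, [/\ ~~ odd e, 2 <= e, odd o & 3 <= o] /\
    [/\ 1 <= i - e, i + 2 * j + o <= n, a = i - e & b = i + 2 * j + o].

Definition all_bicoloured (R : nat -> nat -> Prop) : Prop :=
  forall a b, R a b -> bicoloured H (v a) (v b).

Definition right_leaning (i j : nat) : Prop := all_bicoloured (right_pair i j).
Definition left_leaning (i j : nat) : Prop := all_bicoloured (left_pair i j).

Definition no_edges_besides (R : nat -> nat -> Prop) : Prop :=
  forall a b, 0 < a <= n -> 0 < b <= n -> edge H (v a) (v b) ->
    [\/ a = b.+1, b = a.+1, R a b | R b a].

Definition right_segmented : Prop :=
  (forall i j, segment i j -> right_leaning i j) /\
  no_edges_besides (fun a b => exists i j, segment i j /\ right_pair i j a b).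

Definition left_segmented : Prop :=
  (forall i j, segment i j -> left_leaning i j) /\
  no_edges_besides (fun a b => exists i j, segment i j /\ left_pair i j a b).

Definition two_sided_segment (i j : nat) : Prop :=
  [/\ segment i j, left_leaning i j & right_leaning i j].

Definition left_right_segmented : Prop :=
  exists i j,
    [/\ two_sided_segment i j,
        forall i' j', two_sided_segment i' j' -> i' = i /\ j' = j,
        forall i' j', segment i' j' -> i' < i -> left_leaning i' j'
      & forall i' j', segment i' j' -> i < i' -> right_leaning i' j'] /\
    all_bicoloured (cross_pair i j) /\
    no_edges_besides (fun a b =>
      [\/ exists i' j', [/\ segment i' j', i' <= i & left_pair i' j' a b],
          exists i' j', [/\ segment i' j', i <= i' & right_pair i' j' a b]
        | cross_pair i j a b]).

(* Segments are pieces of the path lying one after the other: two distinct ones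
   share at most an end vertex. Maximality alone does not exclude segments of
   opposite parity overlapping in an edge: on the path v_1 ... v_5 with
   additional bicoloured edges v_1 v_4 and v_2 v_5, the subpaths v_1 ... v_4 and
   v_2 ... v_5 are both maximal and right-leaning, yet there is no special min
   ordering, as v_2 forces v_5 before v_1 and v_4 forces v_1 before v_5. *)
Definition segments_edge_disjoint : Prop :=
  forall i j i' j', segment i j -> segment i' j' -> i < i' ->
    i + 2 * j + 1 <= i'.

End PathSeparable.

Definition path_separable (V : finType) (H : signed_graph V) : Prop :=
  irreflexive_sg H /\ exists v, unicoloured_spanning_path H v.

Definition segmented (V : finType) (H : signed_graph V) : Prop :=
  exists v, [/\ unicoloured_spanning_path H v, segments_edge_disjoint H v
    & [\/ right_segmented H v, left_segmented H v | left_right_segmented H v]].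

(** * Polynomial time *)

(* The model is the unit-cost random access machine with addition and truncated
   subtraction but no multiplication, which is polynomially equivalent to Turing
   machines. Registers are indexed by [nat], hold naturals and are initially 0;
   the input is a read-only bit string. *)
Inductive instr :=
| Const (r k : nat)      (* R[r] := k *)
| Add (r s t : nat)      (* R[r] := R[s] + R[t] *)
| Sub (r s t : nat)      (* R[r] := R[s] - R[t] *)
| LoadInd (r s : nat)       (* R[r] := R[R[s]] *)
| StoreInd (r s : nat)      (* R[R[r]] := R[s] *)
| Read (r s : nat)       (* R[r] := input bit number R[s], or 2 past the end *)
| JumpPos (r l : nat)    (* if R[r] > 0, go to instruction l *)
| Accept
| Reject.

Definition program := seq instr.
Definition memory := nat -> nat.

Definition update (m : memory) (r k : nat) : memory :=
  fun s => if s == r then k else m s.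

(* [run p w t pc m] is the verdict reached within [t] steps from instruction
   [pc] and memory [m], or [None] if the machine is still running by then.
   Leaving the program rejects. *)
Fixpoint run (p : program) (w : bitseq) (t pc : nat) (m : memory) :
    option bool :=
  if t is t'.+1 then
    match onth p pc with
    | None | Some Reject => Some false
    | Some Accept => Some true
    | Some (Const r k) => run p w t' pc.+1 (update m r k)
    | Some (Add r s u) => run p w t' pc.+1 (update m r (m s + m u))
    | Some (Sub r s u) => run p w t' pc.+1 (update m r (m s - m u))
    | Some (LoadInd r s) => run p w t' pc.+1 (update m r (m (m s)))
    | Some (StoreInd r s) => run p w t' pc.+1 (update m (m r) (m s))
    | Some (Read r s) =>
        run p w t' pc.+1 (update m r (nth 2 (map nat_of_bool w) (m s)))
    | Some (JumpPos r l) => run p w t' (if 0 < m r then l else pc.+1) m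
    end
  else None.

Definition verdict (p : program) (w : bitseq) (t : nat) : option bool :=
  run p w t 0 (fun=> 0).

Definition polynomial_time_solvable (I : Type) (encode : I -> bitseq)
    (yes : I -> Prop) : Prop :=
  exists (p : program) (q : {poly nat}), forall x : I,
    exists2 b, verdict p (encode x) q.[size (encode x)]%R = Some b
             & b <-> yes x.

(** * The list homomorphism problem *)

Record instance (W : finType) := Instance {
  inst_vertices : finType;
  inst_graph : signed_graph inst_vertices;
  inst_lists : inst_vertices -> {set W} }.

Definition list_s_hom (W : finType) (H : signed_graph W) (x : instance W) :
    Prop :=
  exists f : inst_vertices x -> W,
    sg_hom (inst_graph x) H f /\ forall u, f u \in inst_lists u.

(* The number of vertices in unary, the two adjacency matrices, and the
   incidence matrix of the lists. *)
Definition encode_instance (W : finType) (x : instance W) : bitseq :=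
  let V := inst_vertices x in
  nseq #|V| true ++ [:: false]
    ++ [seq blue (inst_graph x) a b | a <- enum V, b <- enum V]
    ++ [seq red (inst_graph x) a b | a <- enum V, b <- enum V]
    ++ [seq c \in inst_lists a | a <- enum V, c <- enum W].

Definition list_s_hom_polynomial (W : finType) (H : signed_graph W) : Prop :=
  polynomial_time_solvable (@encode_instance W) (list_s_hom H).

(* Main.v *)
Require Import Defs.
From mathcomp Require Import all_boot all_order all_algebra zify boolp.

Set Implicit Arguments.
Unset Strict Implicit.
Unset Printing Implicit Defensive.

(** The ordering: in a segmented graph every bicoloured edge other than the
    "cross" ones joins a source of a segment to all far enough vertices on one
    side.  Listing, in each colour class, the sources so that they move away from
    the two-sided segment and the other vertices so that they come back, the
    neighbourhoods of the sources on their own side are initial segments, and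
    the remaining vertices are joined by path edges only.

    The algorithm: a homomorphism together with the switching is a solution of
    a binary constraint problem with values [(w, s)], where [s] tells whether
    the vertex is switched, and path consistency solves it.  If it refutes no
    vertex, map each vertex to the least available [w].  By the min ordering
    this is a homomorphism of the underlying graphs, and bicoloured edges go to
    bicoloured edges.  Where it uses unicoloured edges only, signs must match
    along every closed walk; path consistency provides another image of such a
    walk, with matching signs and the same starting point, and this image,
    which dominates the least one, is forced by the special ordering to use
    unicoloured edges only.  As these form a path, both images are positive. *)

(** * Min orderings and path consistency *)

(** The order picks the [w] of a value [(w, s)] but says nothing about [s], so the least images come
    without a switch. It is recovered separately: once [H] is switched so that its path is blue, an
    edge of the instance with a unicoloured image prescribes whether the corrected switches of its
    ends differ, and an edge with a bicoloured image prescribes nothing. So only the components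
    formed by edges of the first kind need a potential, and comparing each vertex with the root of
    its component provides one. That the unicoloured edges form a path enters twice: no vertex has
    three unicoloured neighbours, which keeps a dominating walk unicoloured, and a path can be
    switched to blue. The three shapes of segmented graphs are instances of one model with two
    indices [p] and [q]. Its colour classes are listed in opposite directions, because edges within
    and across the two-sided segment join a vertex of one class to those of the other far enough to
    its right. As [H] is fixed, whatever concerns it is unrolled into the program; loops run over
    the vertices of the instance only. *)

Section Colours.
Variables (V : finType) (G : signed_graph V).

Lemma edge_sym : symmetric (edge G).
Proof. by move=> x y; rewrite /edge blue_sym red_sym. Qed.

Lemma bicoloured_sym :
  symmetric (bicoloured G).
Proof. by move=> x y; rewrite /bicoloured blue_sym red_sym. Qed.

Lemma unicoloured_sym :
  symmetric (unicoloured G).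
Proof. by move=> x y; rewrite /unicoloured edge_sym bicoloured_sym. Qed.

Lemma bicoloured_edge x y :
  bicoloured G x y -> edge G x y.
Proof. by rewrite /edge => /andP[->]. Qed.

Lemma unicoloured_edge x y :
  unicoloured G x y -> edge G x y.
Proof. by case/andP. Qed.

Lemma edge_uni_or_bi x y :
  edge G x y -> unicoloured G x y \/ bicoloured G x y.
Proof.
by move=> e; rewrite /unicoloured e; case: bicoloured; [right | left].
Qed.

End Colours.

(** * Walks that dominate a walk of unicoloured edges *)

Section DominatedWalks.
Variables (W : finType) (H : signed_graph W) (side : pred W) (r : W -> nat).
Hypothesis bip : forall x y, edge H x y -> side x != side y.
Hypothesis r_inj : forall x y, side x = side y -> r x = r y -> x = y.
Hypothesis min_r : forall x x' y y', side x = side x' ->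
  r x < r x' -> r y < r y' -> edge H x y' -> edge H x' y -> edge H x y.
Hypothesis special_r : forall x u w,
  bicoloured H x u -> unicoloured H x w -> r u < r w.
Hypothesis deg_uni : forall x a b c, unicoloured H x a -> unicoloured H x b ->
  unicoloured H x c -> [|| a == b, b == c | a == c].

Lemma edge_side x y : edge H x y -> side y = ~~ side x.
Proof. by move=> /bip; case: (side x); case: (side y). Qed.

Section Below.
Variables (x0 y0 : W).
Hypothesis bi0 : bicoloured H x0 y0.

(** The end of the fixed bicoloured edge on the side of [v]; ranks are compared within one side
    only. *)
Let bound v := if side v == side x0 then x0 else y0.
Let below v := r v < r (bound v).

Let side_bound v : side (bound v) = side v.
Proof.
rewrite /bound; case: eqP => // /eqP.
by rewrite (edge_side (bicoloured_edge bi0)); case: side; case: side.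
Qed.

Let bound_bi u v : edge H u v -> bicoloured H (bound u) (bound v).
Proof.
move=> /edge_side; rewrite /bound => ->.
by case: (side u); case: (side x0) => //=; rewrite bicoloured_sym.
Qed.

(* Otherwise [v] would have a third unicoloured neighbour, [bound u]. *)
Lemma below_step u v w : unicoloured H u v -> unicoloured H v w ->
  below v -> below w -> below u.
Proof.
move=> uv vw; have vu := uv; rewrite unicoloured_sym in vu.
have side_wu : side w = side u.
  rewrite (edge_side (unicoloured_edge vw)).
  by rewrite (edge_side (unicoloured_edge uv)) negbK.
have bd_wu : bound w = bound u by rewrite /bound side_wu.
have bi_uv := bound_bi (unicoloured_edge uv).
rewrite /below bd_wu => lt_v lt_w; rewrite ltnNge; apply/negP => le_u.
move: le_u; rewrite leq_eqVlt => /orP[/eqP eq_u|lt_u].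
  have uE : bound u = u by apply: r_inj => //; rewrite side_bound.
  rewrite uE in bi_uv.
  by have := special_r bi_uv uv; rewrite ltnNge ltnW.
(* The edges from [v] to [u] and from [bound v] to [bound u] cross, so the min ordering applies. *)
have e_v : edge H v (bound u).
  apply: (min_r (x' := bound v) (y' := u)) => //.
  - exact: unicoloured_edge.
  - by rewrite edge_sym bicoloured_edge.
have [uni_v|bi_v] := edge_uni_or_bi e_v; last first.
  by have := special_r bi_v vw; rewrite ltnNge ltnW.
have := deg_uni vw uni_v vu.
case/or3P => /eqP E.
- by rewrite E ltnn in lt_w.
- by rewrite E ltnn in lt_u.
- by rewrite E in lt_w; have := ltn_trans lt_w lt_u; rewrite ltnn.
Qed.

End Below.

(* Let [x0 y0] be the first bicoloured edge of [b].  By [below_step] no vertex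
   of [a] up to there reaches [x0] or [y0] in the ordering, going backwards, and
   hence no vertex of [b] does, going forwards from the common start; but [x0]
   itself is on [b]. *)
Lemma dominated_walk (a b : nat -> W) k : a 0 = b 0 ->
  (forall j, j < k -> unicoloured H (a j) (a j.+1)) ->
  (forall j, j < k -> edge H (b j) (b j.+1)) ->
  (forall j, j <= k -> r (a j) <= r (b j)) ->
  forall j, j < k -> unicoloured H (b j) (b j.+1).
Proof.
move=> ab0 uni_a edge_b le_ab.
have side_ab j : j <= k -> side (a j) = side (b j).
  elim: j => [|j IHj] jk; first by rewrite ab0.
  rewrite (edge_side (unicoloured_edge (uni_a _ jk))) IHj 1?ltnW //.
  by rewrite (edge_side (edge_b _ jk)).
elim/ltn_ind => i IHi ik; have uni_b j : j < i -> unicoloured H (b j) (b j.+1).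
  by move=> ji; apply: IHi => //; apply: ltn_trans ji ik.
have [//|bi] := edge_uni_or_bi (edge_b _ ik); exfalso.
have uni_i := uni_a _ ik.
pose below v := r v < r (if side v == side (b i) then b i else b i.+1).
have below_i : below (a i).
  rewrite /below (side_ab _ (ltnW ik)) eqxx ltn_neqAle (le_ab _ (ltnW ik)) andbT.
  apply/eqP => /(r_inj (side_ab _ (ltnW ik))) E; rewrite E in uni_i.
  by have := special_r bi uni_i; rewrite ltnNge le_ab.
have below_i1 : below (a i.+1).
  rewrite /below side_ab // (edge_side (edge_b _ ik)).
  have -> : (~~ side (b i) == side (b i)) = false by case: side.
  rewrite ltn_neqAle le_ab // andbT.
  apply/eqP => /(r_inj (side_ab _ ik)) E; rewrite E unicoloured_sym in uni_i.
  rewrite bicoloured_sym in bi.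
  by have := special_r bi uni_i; rewrite ltnNge le_ab // 1?ltnW.
have below_a j : j <= i -> below (a (i - j)) /\ below (a (i - j).+1).
  elim: j => [|j IHj] ji; first by rewrite subn0.
  have [|lo hi] := IHj; first exact: ltnW.
  have E : (i - j.+1).+1 = i - j by lia.
  rewrite E; split=> //; apply: (below_step bi _ _ lo hi).
    by rewrite -E; apply: uni_a; lia.
  by apply: uni_a; lia.
have [below_a0 below_a1] : below (a 0) /\ below (a 1).
  by have := below_a i (leqnn i); rewrite subnn.
have below_b j : j <= i -> below (b j) /\ (j < i -> below (b j.+1)).
  elim: j => [|j IHj] ji.
    split=> [|i0]; first by rewrite -ab0.
    apply: (below_step bi _ _ below_a0 below_a1); last by apply: uni_a; lia.
    by rewrite unicoloured_sym ab0; apply: IHi => //; lia.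
  have [lo hi] := IHj (ltnW ji); split=> [|ji1]; first exact: hi.
  apply: (below_step bi _ _ (hi ji) lo); rewrite unicoloured_sym.
    by apply: uni_b.
  by apply: uni_b.
by have [] := below_b i (leqnn i); rewrite /below eqxx ltnn.
Qed.

End DominatedWalks.

Lemma connect_walk (T : finType) (e : rel T) x y : connect e x y ->
  exists k (w : nat -> T), [/\ w 0 = x, w k = y
    & forall j, j < k -> e (w j) (w j.+1)].
Proof.
case/connectP => s /(pathP x) e_s ->; exists (size s), (nth x (x :: s)).
by split=> //; rewrite (last_nth x).
Qed.

(** * From a path-consistent relation to a homomorphism *)

Section Consistency.
Variables (W : finType) (H : signed_graph W).
Variables (V : finType) (G : signed_graph V) (L : V -> {set W}).

(* A value [(w, s)] sends a vertex to [w] after switching it iff [s]. *)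
Definition respects (a b : W * bool) (c : bool) : bool :=
  if (a.2 == b.2) == c then blue H a.1 b.1 else red H a.1 b.1.

Definition allowed (x y : V) (a b : W * bool) : bool :=
  (blue G x y ==> respects a b true) && (red G x y ==> respects a b false).

(** The clause for [x == y] confines the diagonal to equal values, so that [K x x a a] will mean
    that [a] is still available at [x]. *)
Definition refuted (x y : V) (a b : W * bool) : bool :=
  [|| a.1 \notin L x, b.1 \notin L y, (x == y) && (a != b) | ~~ allowed x y a b].

Lemma allowed_edge x y a b : edge G x y -> allowed x y a b -> edge H a.1 b.1.
Proof.
rewrite /edge /allowed /respects; case: (a.2 == b.2);
by case: (blue G x y); case: (red G x y);
  case: (blue H _ _); case: (red H _ _).
Qed.

Lemma allowed_bicoloured x y a b : bicoloured G x y -> allowed x y a b ->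
  bicoloured H a.1 b.1.
Proof.
move=> /andP[Gb Gr]; rewrite /allowed /respects Gb Gr /bicoloured /=.
by case: (a.2 == b.2) => //= /andP[-> ->].
Qed.

Variables (side : pred W) (r : W -> nat) (sigma : W -> bool).
Hypothesis bip : forall x y, edge H x y -> side x != side y.
Hypothesis r_inj : forall x y, side x = side y -> r x = r y -> x = y.
Hypothesis min_r : forall x x' y y', side x = side x' ->
  r x < r x' -> r y < r y' -> edge H x y' -> edge H x' y -> edge H x y.
Hypothesis special_r : forall x u w,
  bicoloured H x u -> unicoloured H x w -> r u < r w.
Hypothesis deg_uni : forall x a b c, unicoloured H x a -> unicoloured H x b ->
  unicoloured H x c -> [|| a == b, b == c | a == c].
Hypothesis balanced : forall x y, unicoloured H x y ->
  blue H x y = (sigma x == sigma y).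

(** An arbitrary path-consistent relation; the algorithm supplies the complement of its marked
    tuples. *)
Variable K : V -> V -> W * bool -> W * bool -> bool.
Hypothesis K_base : forall x y a b, K x y a b -> ~~ refuted x y a b.
Hypothesis K_path : forall x y a b z, K x y a b ->
  exists c, K x z a c && K z y c b.
Hypothesis K_nonempty : forall x, exists a, K x x a a.

Lemma K_allowed x y a b : K x y a b -> allowed x y a b.
Proof. by move=> /K_base; rewrite /refuted !negb_or => /and4P[_ _ _ /negPn]. Qed.

Lemma K_diag x a b : K x x a b -> a = b.
Proof.
move=> /K_base; rewrite /refuted !negb_or eqxx /= => /and4P[_ _ + _].
by move=> /negPn/eqP.
Qed.

Lemma K_right x y a b : K x y a b -> K y y b b.
Proof. by move=> /(K_path y)[c /andP[_ K1]]; have := K1; rewrite -(K_diag K1). Qed.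

Lemma K_extend x a y : K x x a a -> exists b, K x y a b.
Proof. by move=> /(K_path y)[c /andP[K1 _]]; exists c. Qed.

(** Path consistency at the last but one vertex supplies its value, and induction the others. All of
    them stay related to the value at the start, but a vertex met twice may receive two different
    values. *)
Lemma K_walk (x : nat -> V) k a b : K (x 0) (x k) a b ->
  exists g : nat -> W * bool, [/\ g 0 = a, g k = b,
    forall j, j <= k -> K (x 0) (x j) a (g j)
    & forall j, j < k -> allowed (x j) (x j.+1) (g j) (g j.+1)].
Proof.
elim: k b => [|k IHk] b Kab.
  by exists (fun=> a); split=> // [|j]; [apply: K_diag Kab
    | rewrite leqn0 => /eqP->; have := Kab; rewrite -(K_diag Kab)].
have [c /andP[Kac Kcb]] := K_path (x k) Kab.
have [g [g0 gk Kg ag]] := IHk c Kac.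
exists (fun j => if j <= k then g j else b); split=> //.
- by rewrite ltnn.
- by move=> j; case: (ltngtP j k.+1) => // [jk|->] _; [rewrite -ltnS jk Kg | rewrite ltnn].
move=> j; rewrite ltnS /=; case: (ltngtP j k) => // [jk|->] _.
  exact: ag.
by rewrite gk; apply: K_allowed.
Qed.

Let adj_sym : connect_sym (edge G).
Proof. exact/sym_connect_sym/edge_sym. Qed.

(** A component of the instance might be mapped with its two sides either way round. Committing to
    one value at its root settles this, as needed to compare values by [r]. *)
Let anchor x := xchoose (K_nonempty x).

Let anchorP x : K x x (anchor x) (anchor x).
Proof. exact: (xchooseP (K_nonempty x)). Qed.

Let reached x := xchoose (K_extend x (anchorP (fingraph.root (edge G) x))).

Let reachedP x : K (fingraph.root (edge G) x) x (anchor (fingraph.root (edge G) x))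
  (reached x).
Proof. exact: (xchooseP (K_extend x (anchorP (fingraph.root (edge G) x)))). Qed.

(* The part of [H] that the component of [x] is sent to, seen from [x]. *)
Let part x := side (reached x).1.

Let walk_side (x : nat -> V) k a b :
  (forall j, j < k -> edge G (x j) (x j.+1)) -> K (x 0) (x k) a b ->
  side b.1 = side a.1 (+) odd k.
Proof.
move=> e_x /K_walk[g [g0 gk _ ag]]; rewrite -gk.
have : k <= k by []; elim: {1 3 4}k => [|j IHj] jk; first by rewrite g0 addbF.
have := bip (allowed_edge (e_x _ jk) (ag _ jk)); rewrite IHj 1?ltnW //=.
by case: (side a.1); case: (odd j); case: (side _).
Qed.

(** Both values end images of the same walk from the root, along which sides alternate. *)
Let part_unique x b : K (fingraph.root (edge G) x) x (anchor (fingraph.root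
  (edge G) x)) b ->
  side b.1 = part x.
Proof.
have := connect_root (edge G) x; rewrite adj_sym => /connect_walk.
move=> [k [w [w0 wk e_w]]]; have := reachedP x; rewrite /part -w0 -{1 3}wk.
by move=> /(walk_side e_w)-> /(walk_side e_w).
Qed.

Let part_edge x y : edge G x y -> part y = ~~ part x.
Proof.
move=> xy; have := reachedP x => Kx.
have eq_root : fingraph.root (edge G) x = fingraph.root (edge G) y
  by apply/fingraph.rootP/connect1.
have [c /andP[K1 K2]] := K_path y Kx.
rewrite eq_root in K1; rewrite -(part_unique K1) /part.
rewrite edge_sym in xy.
by have := bip (allowed_edge xy (K_allowed K2)); do 2 case: side.
Qed.

Let choices x := [set w | (side w == part x) && [exists s, K x x (w, s) (w, s)]].

Let choicesP x a : K x x a a -> side a.1 = part x -> a.1 \in choices x.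
Proof.
case: a => w s /= Kx sw; rewrite inE sw eqxx.
by apply/existsP; exists s.
Qed.

Let f x := [arg min_(w < (reached x).1 in choices x) r w].

Let fP x : f x \in choices x /\ forall w, w \in choices x -> r (f x) <= r w.
Proof.
rewrite /f; case: arg_minnP => //.
by apply: choicesP => //; apply: K_right (reachedP x).
Qed.

Let f_part x : side (f x) = part x.
Proof. by have [+ _] := fP x; rewrite inE => /andP[/eqP]. Qed.

Let f_sign x : exists s, K x x (f x, s) (f x, s).
Proof. by have [+ _] := fP x; rewrite inE => /andP[_ /existsP]. Qed.

Let f_support x y : edge G x y -> exists b : W * bool,
  [/\ b.1 \in choices y, edge H (f x) b.1
    & bicoloured G x y -> bicoloured H (f x) b.1].
Proof.
move=> xy; have [s Kx] := f_sign x; have [b Kb] := K_extend y Kx.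
exists b; have e_b := allowed_edge xy (K_allowed Kb); split=> //.
  apply: choicesP; first exact: K_right Kb.
  by rewrite (edge_side bip e_b) /= f_part (part_edge xy).
by move=> bi; apply: (allowed_bicoloured bi (K_allowed Kb)).
Qed.

Let f_edge x y : edge G x y -> edge H (f x) (f y).
Proof.
(* [b] supports [f x] at [y], and [a] supports [f y] at [x]. Both dominate the least choices, so the
   min ordering uncrosses the two edges. *)
move=> xy; have [b [b_y e_b _]] := f_support xy.
have yx := xy; rewrite edge_sym in yx.
have [a [a_x e_a _]] := f_support yx; rewrite edge_sym in e_a.
have side_a : side (f x) = side a.1.
  by rewrite f_part; move: a_x; rewrite inE => /andP[/eqP].
have side_b : side (f y) = side b.1.
  by rewrite f_part; move: b_y; rewrite inE => /andP[/eqP].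
have := (fP x).2 _ a_x; rewrite leq_eqVlt => /orP[/eqP E|lt_a].
  by rewrite (r_inj side_a E).
have := (fP y).2 _ b_y; rewrite leq_eqVlt => /orP[/eqP E|lt_b].
  by rewrite (r_inj side_b E).
exact: min_r side_a lt_a lt_b e_b e_a.
Qed.

(** If the edge from [f x] to [f y] were unicoloured, the bicoloured support [b] of [f x] would
    precede [f y], which is least. *)
Let f_bicoloured x y : bicoloured G x y -> bicoloured H (f x) (f y).
Proof.
move=> bi; have xy := bicoloured_edge bi.
have [b [b_y _ /(_ bi) bi_b]] := f_support xy.
have [uni|//] := edge_uni_or_bi (f_edge xy).
by have := special_r bi_b uni; rewrite ltnNge (fP y).2.
Qed.

(** The edges along which the switch is not free: the images of all other edges are bicoloured and
    accept any sign. *)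
Let tight : rel V := fun x y => edge G x y && unicoloured H (f x) (f y).

Let tight_sym : connect_sym tight.
Proof.
by apply: sym_connect_sym => x y; rewrite /tight edge_sym unicoloured_sym.
Qed.

Let start x : W * bool := (f x, xchoose (f_sign x)).

Let startP x : K x x (start x) (start x).
Proof. exact: (xchooseP (f_sign x)). Qed.

(** The switch of a value, corrected by the switching [sigma] of [H] that turns all unicoloured
    edges blue. *)
Let charge (a : W * bool) : bool := a.2 (+) sigma a.1.

Let charge_step x y a b : unicoloured G x y -> unicoloured H a.1 b.1 ->
  allowed x y a b -> charge a (+) charge b = red G x y.
Proof.
move=> uG uH; have := balanced uH; move: uG uH.
rewrite /unicoloured /edge /bicoloured /allowed /respects /charge.
case: a b => [a s] [b s'] /=; case: (sigma a); case: (sigma b);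
case: (blue H a b); case: (red H a b) => //=;
by case: (blue G x y); case: (red G x y) => //=; case: s; case: s'.
Qed.

(** The values from [K_walk] dominate the images under [f], which are least, and start at the same
    image. Hence [dominated_walk] makes their edges unicoloured, and [charge_step] applies. *)
Let tight_walk (x : nat -> V) k b :
  (forall j, j < k -> tight (x j) (x j.+1)) ->
  K (x 0) (x k) (start (x 0)) b ->
  exists g : nat -> W * bool, [/\ g 0 = start (x 0), g k = b,
    forall j, j <= k -> K (x 0) (x j) (start (x 0)) (g j)
    & forall j, j < k ->
      charge (g j) (+) charge (g j.+1) = red G (x j) (x j.+1)].
Proof.
move=> e_x /K_walk[g [g0 gk Kg ag]]; exists g; split=> // j jk.
have adj i : i < k -> edge G (x i) (x i.+1) by move=> /e_x/andP[].
have uni i : i < k -> unicoloured H (f (x i)) (f (x i.+1)).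
  by move=> /e_x/andP[].
have part_g i : i <= k -> side (g i).1 = part (x i).
  elim: i => [|i IHi] ik; first by rewrite g0 /= f_part.
  rewrite (edge_side bip (allowed_edge (adj _ ik) (ag _ ik))) IHi 1?ltnW //.
  by rewrite (part_edge (adj _ ik)).
have uni_g := @dominated_walk _ _ side r bip r_inj min_r special_r deg_uni
  (fun i => f (x i)) (fun i => (g i).1) k.
apply: charge_step; last exact: ag.
  have [//|bi] := edge_uni_or_bi (adj _ jk).
  by have := uni _ jk; rewrite /unicoloured f_bicoloured // andbF.
apply: uni_g => //; first by rewrite g0.
  by move=> i ik; apply: allowed_edge (adj _ ik) (ag _ ik).
move=> i ik; apply: (fP _).2; apply: choicesP (part_g _ ik).
exact: K_right (Kg _ ik).
Qed.

(** Both values end chains with the same initial charge, whose changes are prescribed by the signs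
    of the instance along one walk. *)
Let charge_unique x a b : let z := fingraph.root tight x in
  K z x (start z) a -> K z x (start z) b -> charge a = charge b.
Proof.
move=> z; have := connect_root tight x; rewrite tight_sym => /connect_walk.
move=> [k [w [w0 wk e_w]]]; rewrite -/z in w0; rewrite -w0 -wk.
move=> /(tight_walk e_w)[g [g0 gk _ cg]] /(tight_walk e_w)[h [h0 hk _ ch]].
rewrite -gk -hk; have : k <= k by []; elim: {1 3 4}k => [|j IHj] jk.
  by rewrite g0 h0.
have := cg _ jk; rewrite -(ch _ jk) IHj 1?ltnW // => /addbI; exact.
Qed.

Let potential x := charge (xchoose (K_extend x (startP (fingraph.root tight x)))).

Let potentialP x b : K (fingraph.root tight x) x (start (fingraph.root tight x)) b ->
  charge b = potential x.
Proof. by move=> Kb; apply: charge_unique Kb (xchooseP _). Qed.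

Let potential_tight x y : tight x y ->
  potential x (+) potential y = red G x y.
Proof.
move=> xy; have eq_root : fingraph.root tight x = fingraph.root tight y
  by apply/fingraph.rootP/connect1.
have := connect_root tight x; rewrite tight_sym => /connect_walk.
move=> [k [w [w0 wk e_w]]].
(* With the walk prolonged to [y], a single chain of values ends in the one chosen at [y] and passes
   through one at [x] related to the same root. *)
pose w' j := if j <= k then w j else y.
have e_w' j : j < k.+1 -> tight (w' j) (w' j.+1).
  rewrite ltnS /w'; case: (ltngtP j k) => // [jk|->] _; first exact: e_w.
  by rewrite wk.
have := xchooseP (K_extend y (startP (fingraph.root tight y))).
have w'0 : w' 0 = fingraph.root tight y by rewrite /w' /= w0.
have w'k : w' k = x by rewrite /w' leqnn wk.
have w'k1 : w' k.+1 = y by rewrite /w' ltnn.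
rewrite /potential; set c := xchoose _.
rewrite -{1 2}w'0 -{1}w'k1 => /(tight_walk e_w')[g [_ gk Kg cg]].
have := cg k (ltnSn k); rewrite gk w'k w'k1 => <-; congr (_ (+) _).
apply/esym/potentialP; have := Kg k (leqnSn k).
by rewrite w'k w'0 eq_root.
Qed.

Lemma consistent_hom : exists h : V -> W * bool,
  (forall x y, allowed x y (h x) (h y)) /\ forall x, (h x).1 \in L x.
Proof.
(* With this switch the value at [x] has charge [potential x]. *)
exists (fun x => (f x, potential x (+) sigma (f x))); split=> [x y|x] /=.
  rewrite /allowed /respects /=.
  have [xy|] := boolP (edge G x y); last first.
    by rewrite /edge negb_or => /andP[/negPf-> /negPf->].
  have [uni|bi] := edge_uni_or_bi (f_edge xy); last first.
    by case/andP: bi => bl re; apply/andP; split; apply/implyP => _; case: ifP.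
  have := @potential_tight x y; rewrite /tight xy uni => /(_ isT).
  have uG : unicoloured G x y.
    have [//|bi] := edge_uni_or_bi xy.
    by move: uni; rewrite /unicoloured f_bicoloured // andbF.
  have := balanced uni; move: uni uG; rewrite /unicoloured /edge /bicoloured.
  case: (sigma (f x)); case: (sigma (f y)); case: (potential x);
  case: (potential y); case: (blue H _ _); case: (red H _ _) => //=;
  by case: (blue G x y); case: (red G x y).
have [s /K_base] := f_sign x.
by rewrite /refuted !negb_or => /and4P[/negPn].
Qed.

End Consistency.

(** * Bounded loops on the random access machine *)

Section Reaches.
Variables (p : program) (w : bitseq).

(** Since the remaining fuel [t'] is arbitrary, stretches of a computation compose and their step
    counts add up. *)
Definition reaches (pc : nat) (m : memory) (B pc' : nat)
    (Q : memory -> Prop) : Prop :=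
  exists t m', [/\ t <= B, Q m'
    & forall t', run p w (t + t') pc m = run p w t' pc' m'].

Lemma reaches_refl pc m B (Q : memory -> Prop) : Q m -> reaches pc m B pc Q.
Proof. by move=> Qm; exists 0, m. Qed.

Lemma reaches_trans B1 B2 pc1 (Q1 : memory -> Prop) pc m B pc' Q :
  reaches pc m B1 pc1 Q1 ->
  (forall m1, Q1 m1 -> reaches pc1 m1 B2 pc' Q) ->
  B1 + B2 <= B -> reaches pc m B pc' Q.
Proof.
move=> [t1 [m1 [le1 Qm1 run1]]] next leB.
have [t2 [m2 [le2 Qm2 run2]]] := next _ Qm1.
exists (t1 + t2), m2; split=> //; first by apply: leq_trans leB; apply: leq_add.
by move=> t'; rewrite -addnA run1 run2.
Qed.

Definition code_at (pc : nat) (c : program) : Prop :=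
  exists p1 p2, p = p1 ++ c ++ p2 /\ size p1 = pc.

Lemma code_at_cat pc c1 c2 :
  code_at pc (c1 ++ c2) -> code_at pc c1 /\ code_at (pc + size c1) c2.
Proof.
rewrite /code_at => -[p1 [p2 [-> <-]]].
split; first by exists p1, (c2 ++ p2); rewrite -!catA.
by exists (p1 ++ c1), p2; rewrite size_cat -!catA.
Qed.

Lemma code_at_head pc i c : code_at pc (i :: c) -> onth p pc = Some i.
Proof. by move=> [p1 [p2 [-> <-]]]; elim: p1 => [|j p1 /= ->]. Qed.

Definition straight (i : instr) : bool :=
  match i with JumpPos _ _ | Accept | Reject => false | _ => true end.

Definition effect (m : memory) (i : instr) : memory :=
  match i with
  | Const r k => update m r k
  | Add r s u => update m r (m s + m u)
  | Defs.Sub r s u => update m r (m s - m u)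
  | LoadInd r s => update m r (m (m s))
  | StoreInd r s => update m (m r) (m s)
  | Read r s => update m r (nth 2 (map nat_of_bool w) (m s))
  | _ => m
  end.

Lemma reaches_block c pc m B (Q : memory -> Prop) :
  code_at pc c -> all straight c -> size c <= B -> Q (foldl effect m c) ->
  reaches pc m B (pc + size c) Q.
Proof.
elim: c pc m B => [|i c IHc] pc m B.
  by rewrite addn0 => *; apply: reaches_refl.
move=> code_c /= /andP[str_i str_c] szB Qc.
have [_ code_c'] := @code_at_cat pc [:: i] c code_c.
case: B szB => // B szB.
have [t [m' [le_t Qm' run_t]]] :=
  IHc (pc + 1) (effect m i) B code_c' str_c szB Qc.
exists t.+1, m'; split=> // t'; rewrite addSn /=.
rewrite (code_at_head code_c).
move: (run_t t'); rewrite addn1 addSnnS.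
by case: i str_i {code_c code_c' Qc run_t}.
Qed.

Lemma reaches_jump pc r l m B (Q : memory -> Prop) :
  onth p pc = Some (JumpPos r l) -> 0 < B -> Q m ->
  reaches pc m B (if 0 < m r then l else pc.+1) Q.
Proof. by move=> pcP B0 Qm; exists 1, m; split=> // t'; rewrite /= pcP. Qed.

End Reaches.

(* Variable [k] of the source language lives at address [2k], cell [i] of its
   array at address [2i + 1]; variable [0] holds the number of vertices. *)
Inductive expr :=
| Var (k : nat)
| Lit (c : nat)
| Plus (e1 e2 : expr)
| Minus (e1 e2 : expr)
| Bit (e : expr)
| Cell (e : expr)
| Sum (v : nat) (e : expr).

Fixpoint eval (w : bitseq) (env arr : memory) (e : expr) : nat :=
  match e with
  | Var k => env k
  | Lit c => c
  | Plus e1 e2 => eval w env arr e1 + eval w env arr e2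
  | Minus e1 e2 => eval w env arr e1 - eval w env arr e2
  | Bit e => nth 2 (map nat_of_bool w) (eval w env arr e)
  | Cell e => arr (eval w env arr e)
  | Sum v e => \sum_(i < env 0) eval w (update env v i) arr e
  end.

Fixpoint scoped (l : nat) (e : expr) : bool :=
  match e with
  | Var k => k < l
  | Lit _ => true
  | Plus e1 e2 | Minus e1 e2 => scoped l e1 && scoped l e2
  | Bit e | Cell e => scoped l e
  | Sum v e => (0 < v < l) && scoped l e
  end.

Lemma scoped_leq l l' e : l <= l' -> scoped l e -> scoped l' e.
Proof.
move=> le_l; elim: e => //=.
- by move=> k /leq_trans; apply.
- by move=> e1 IH1 e2 IH2 /andP[/IH1-> /IH2->].
- by move=> e1 IH1 e2 IH2 /andP[/IH1-> /IH2->].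
- by move=> v e IHe /andP[/andP[-> /leq_trans->//] /IHe->].
Qed.

Lemma eval_ext w l e env env' arr :
  0 < l -> scoped l e -> (forall k, k < l -> env k = env' k) ->
  eval w env arr e = eval w env' arr e.
Proof.
move=> l0; elim: e env env' => //=.
- by move=> k env env' kl ->.
- by move=> e1 IH1 e2 IH2 env env' /andP[s1 s2] E; rewrite (IH1 _ _ s1 E) (IH2 _ _ s2 E).
- by move=> e1 IH1 e2 IH2 env env' /andP[s1 s2] E; rewrite (IH1 _ _ s1 E) (IH2 _ _ s2 E).
- by move=> e IHe env env' s E; rewrite (IHe _ _ s E).
- by move=> e IHe env env' s E; rewrite (IHe _ _ s E).
move=> v e IHe env env' /andP[_ s] E; rewrite (E 0 l0).
by apply: eq_bigr => i _; apply: IHe => // k /E; rewrite /update; case: eqP.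
Qed.

(** Even addresses from [l.*2] on are left open: they are the scratch registers. *)
Definition represents (l : nat) (env arr m : memory) : Prop :=
  (forall k, k < l -> m k.*2 = env k) /\ (forall i, m i.*2.+1 = arr i).

(** The variable [v] is saved in the first scratch register and restored at the end, so that nested
    loops may share a variable. As [t] is [1], the first jump is unconditional and leads to the
    test; address [0] holds the number of vertices. *)
Definition loop (l v pc : nat) (body : program) : program :=
  let sv := l.*2 in let t := l.+1.*2 in let x := v.*2 in
  [:: Const sv 0; Add sv sv x; Const x 0; Const t 1] ++
  [:: JumpPos t (pc + 5 + size body + 2)] ++ body ++
  [:: Const t 1; Add x x t] ++ [:: Defs.Sub t 0 x] ++ [:: JumpPos t (pc + 5)] ++
  [:: Const x 0; Add x x sv].

(** Both the environment and the array may vary with the round, since [Sum] changes its accumulator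
    and [For] the array. Entering takes 5 steps, each round 4 besides the body, the failing test 2
    and the restoration of [v] 2. *)
Lemma loop_reaches p w pc l v body n B m (env arr : nat -> memory) :
  code_at p pc (loop l v pc body) -> 0 < v < l ->
  (forall i, i <= n -> env i 0 = n /\ env i v = env 0 v) ->
  represents l (env 0) (arr 0) m ->
  (forall i m, i < n ->
    represents l.+1 (update (update (env i) l (env 0 v)) v i) (arr i) m ->
    reaches p w (pc + 5) m B (pc + 5 + size body)
      (represents l.+1 (update (update (env i.+1) l (env 0 v)) v i) (arr i.+1))) ->
  reaches p w pc m (9 + n * (B + 4)) (pc + size (loop l v pc body))
    (represents l (env n) (arr n)).
Proof.
move=> code_loop /andP[v0 vl] envP repr0 bodyP.
have szE : size (loop l v pc body) = size body + 11.
  by rewrite /loop !size_cat /= !addnS addn0.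
have [c_init] := code_at_cat code_loop.
move=> /code_at_cat [/code_at_head c_jmp1].
move=> /code_at_cat [_]; move=> /code_at_cat [c_incr].
move=> /code_at_cat [c_test]; move=> /code_at_cat [/code_at_head c_jmp2 c_rest].
rewrite /= in c_init c_jmp1 c_incr c_test c_jmp2 c_rest.
set test := pc + 5 + size body + 2.
set inv := fun i => represents l.+1 (update (update (env i) l (env 0 v)) v i) (arr i).
have testP k i m1 : i + k = n -> inv i m1 ->
    reaches p w test m1 (k * (B + 4) + 2) (test + 2) (inv n).
  elim: k i m1 => [|k IHk] i m1 ik inv_i.
    have iE : i = n by lia.
    subst i.
    apply: (@reaches_trans _ _ 1 1 (test + 1) (fun m' => inv n m' /\ m' l.+1.*2 = 0)) => //.
      have := @reaches_block p w [:: Defs.Sub l.+1.*2 0 v.*2] test m1 1.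
      apply=> //=; first by move: c_test; rewrite /test; congr code_at; lia.
      case: inv_i => invl inva; split; last first.
        have := invl 0 isT; have := invl v (ltnW vl); rewrite /= /update eqxx.
        move=> -> ; rewrite double0 => ->; rewrite eqxx.
        have [-> _] := envP n (leqnn n).
        by do 2 (case: eqP => [?|_]; first lia); rewrite subnn.
      split=> [j jl|j]; rewrite /update /=; case: eqP => [?|_]; try lia.
        by rewrite invl.
      exact: inva.
    move=> m2 [inv2 m2t].
    have := @reaches_jump p w (test + 1) l.+1.*2 (pc + 5) m2 1 (inv n).
    rewrite m2t /= -addnS => H; apply: H => //.
    by move: c_jmp2; congr (onth _ _ = Some (JumpPos _ _)); rewrite /test; lia.
  have i_lt : i < n by lia.
  apply: (@reaches_trans _ _ 1 (k * (B + 4) + (B + 3) + 2) (test + 1)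
    (fun m' => inv i m' /\ 0 < m' l.+1.*2)) => //; last lia.
    have := @reaches_block p w [:: Defs.Sub l.+1.*2 0 v.*2] test m1 1.
    apply=> //=; first by move: c_test; rewrite /test; congr code_at; lia.
    case: inv_i => invl inva; split; last first.
      have := invl 0 isT; have := invl v (ltnW vl); rewrite /= /update eqxx.
      move=> -> ; rewrite double0 => ->; rewrite eqxx.
      have [-> _] := envP i (ltnW i_lt).
      by do 2 (case: eqP => [?|_]; first lia); rewrite subn_gt0.
    split=> [j jl|j]; rewrite /update /=; case: eqP => [?|_]; try lia.
      by rewrite invl.
    exact: inva.
  move=> m2 [inv2 m2t].
  apply: (@reaches_trans _ _ 1 (B + (k * (B + 4) + 2 + 2)) (pc + 5) (inv i)) => //;
    last lia.
    have := @reaches_jump p w (test + 1) l.+1.*2 (pc + 5) m2 1 (inv i).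
    rewrite m2t; apply=> //.
    by move: c_jmp2; congr (onth _ _ = Some (JumpPos _ _)); rewrite /test; lia.
  move=> m3 inv3.
  apply: (@reaches_trans _ _ B _ _ _ _ _ _ _ _ (bodyP i m3 i_lt inv3));
    last by apply: leqnn.
  move=> m4 [inv4 inv4a].
  apply: (@reaches_trans _ _ 2 (k * (B + 4) + 2) test (inv i.+1)); last lia.
    have := @reaches_block p w [:: Const l.+1.*2 1; Add v.*2 v.*2 l.+1.*2]
      (pc + 5 + size body) m4 2.
    apply=> //=; first by move: c_incr; congr code_at; lia.
    split=> [j jl|j]; rewrite /update /=; last first.
      by do 2 (case: eqP => [?|_]; first lia).
    have [jv|jv] := eqVneq j v.
      rewrite jv eqxx; case: eqP => [?|_]; first lia.
      by rewrite eqxx (inv4 v) 1?ltnW // /update eqxx addn1.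
    case: eqP => [?|_]; first lia.
    case: eqP => [?|_]; first lia.
    by rewrite inv4 // /update (negPf jv).
  by move=> m5 inv5; apply: (IHk i.+1) => //; lia.
rewrite szE.
apply: (@reaches_trans _ _ 4 (n * (B + 4) + 5) (pc + 4)
  (fun m' => inv 0 m' /\ m' l.+1.*2 = 1)); last lia.
  have := @reaches_block p w
    [:: Const l.*2 0; Add l.*2 l.*2 v.*2; Const v.*2 0; Const l.+1.*2 1] pc m 4.
  apply=> //=.
  case: repr0 => rl ra; split; last by rewrite /update eqxx.
  split=> [j jl|j]; rewrite /update /=; last first.
    by do 3 (case: eqP => [?|_]; first lia); apply: ra.
  case: eqP => [?|_]; first lia.
  have [jv|jv] := eqVneq j v; first by rewrite jv eqxx.
  case: eqP => [?|_]; first lia.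
  have [jE|jE] := eqVneq j l.
    rewrite jE eqxx; case: eqP => [?|_]; first lia.
    by rewrite rl.
  case: eqP => [?|_]; first lia.
  by rewrite rl; lia.
move=> m1 [inv1 m1t].
apply: (@reaches_trans _ _ 1 (n * (B + 4) + 4) test (inv 0)); last lia.
  have := @reaches_jump p w (pc + 4) l.+1.*2 test m1 1 (inv 0).
  by rewrite m1t; apply.
move=> m2 inv2.
apply: (@reaches_trans _ _ _ 2 _ _ _ _ _ _ _ (testP n 0 m2 (add0n n) inv2)); last lia.
move=> m3 [inv3 inv3a].
have := @reaches_block p w [:: Const v.*2 0; Add v.*2 v.*2 l.*2] (test + 2) m3 2.
have -> : test + 2 + size [:: Const v.*2 0; Add v.*2 v.*2 l.*2] = pc + (size body + 11).
  by rewrite /test /=; lia.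
apply=> //=; first by move: c_rest; rewrite /test; congr code_at; lia.
split=> [j jl|j]; rewrite /update /=; last first.
  by case: eqP => [?|_]; [lia | apply: inv3a].
have [jv|jv] := eqVneq j v.
  rewrite jv eqxx; case: eqP => [?|_]; first lia.
  rewrite inv3 // /update; case: eqP => [?|_]; first lia.
  by rewrite eqxx; have [_ ->] := envP n (leqnn n).
case: eqP => [?|_]; first lia.
rewrite inv3 ?(leqW jl) // /update (negPf jv); case: eqP => [?|_] //; lia.
Qed.

(** The value ends up at address [l.*2]; jumps are absolute, hence the argument [pc]. A [Sum]
    accumulates in variable [l], its loop saves [v] in [l.+1], and the summands are computed in
    [l.+2]. *)
Fixpoint code (l pc : nat) (e : expr) : program :=
  match e with
  | Var k => [:: Const l.*2 0; Add l.*2 l.*2 k.*2]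
  | Lit c => [:: Const l.*2 c]
  | Plus e1 e2 =>
    let c1 := code l pc e1 in
    c1 ++ code l.+1 (pc + size c1) e2 ++ [:: Add l.*2 l.*2 l.+1.*2]
  | Minus e1 e2 =>
    let c1 := code l pc e1 in
    c1 ++ code l.+1 (pc + size c1) e2 ++ [:: Defs.Sub l.*2 l.*2 l.+1.*2]
  | Bit e => code l pc e ++ [:: Read l.*2 l.*2]
  | Cell e => code l pc e ++
    [:: Add l.*2 l.*2 l.*2; Const l.+1.*2 1; Add l.*2 l.*2 l.+1.*2;
        LoadInd l.*2 l.*2]
  | Sum v e => Const l.*2 0 ::
    loop l.+1 v pc.+1 (code l.+2 (pc + 6) e ++ [:: Add l.*2 l.*2 l.+2.*2])
  end.

(** In a round of [Sum], [5] is the loop overhead [4] plus the addition to the accumulator; [10] is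
    the fixed cost [9] of a loop plus the initialisation. The argument will be a bound on the number
    of vertices. *)
Fixpoint cost (e : expr) : {poly nat} :=
  match e with
  | Var _ => 2%N%:P
  | Lit _ => 1%N%:P
  | Plus e1 e2 | Minus e1 e2 => cost e1 + cost e2 + 1%N%:P
  | Bit e => cost e + 1%N%:P
  | Cell e => cost e + 4%N%:P
  | Sum _ e => (cost e + 5%N%:P) * 'X + 10%N%:P
  end%R.

Lemma code_reaches p w N e l pc m env arr :
  code_at p pc (code l pc e) -> 0 < l -> scoped l e -> env 0 <= N ->
  represents l env arr m ->
  reaches p w pc m (cost e).[N]%R (pc + size (code l pc e))
    (represents l.+1 (update env l (eval w env arr e)) arr).
Proof.
elim: e l pc m env => [k|c|e1 IH1 e2 IH2|e1 IH1 e2 IH2|e IHe|e IHe|v e IHe] l pc m env;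
  move=> code_e l0 /= sc n_le repr_m.
- have [rv ra] := repr_m; rewrite hornerC.
  apply: (reaches_block code_e) => //=; split=> [j jl|j]; rewrite /update /=; last first.
    by case: eqP => [?|_]; [lia | apply: ra].
  have [jE|jE] := eqVneq j l.
    by rewrite jE eqxx; case: eqP => [?|_]; [lia | rewrite rv].
  by case: eqP => [?|_]; [lia | apply: rv; lia].
- have [rv ra] := repr_m; rewrite hornerC.
  apply: (reaches_block code_e) => //=; split=> [j jl|j]; rewrite /update /=; last first.
    by case: eqP => [?|_]; [lia | apply: ra].
  have [jE|jE] := eqVneq j l; first by rewrite jE eqxx.
  by case: eqP => [?|_]; [lia | apply: rv; lia].
- have [sc1 sc2] := andP sc; have [code1 code2] := code_at_cat code_e.
  have [{}code2 code3] := code_at_cat code2.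
  rewrite !hornerE !size_cat !addnA.
  apply: (@reaches_trans _ _ _ ((cost e2).[N]%R + 1) _ _ _ _ _ _ _
    (IH1 _ _ _ _ code1 l0 sc1 n_le repr_m)); last lia.
  move=> m1 repr1.
  have l1 : 0 < l.+1 by [].
  have n_le1 : update env l (eval w env arr e1) 0 <= N.
    by rewrite /update; case: eqP => // ?; lia.
  apply: (reaches_trans (IH2 _ _ _ _ code2 l1 (scoped_leq
    (leqnSn l) sc2) n_le1 repr1)); last exact: leqnn.
  move=> m2 [rv ra]; apply: (reaches_block code3) => //=.
  split=> [j jl|j]; rewrite /update /=; last first.
    by case: eqP => [?|_]; [lia | apply: ra].
  have [jE|jE] := eqVneq j l; last first.
    case: eqP => [?|_]; first lia.
    rewrite rv ?(leqW jl) // /update (negPf jE); case: eqP => [?|_] //; lia.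
  rewrite jE eqxx !rv // /update eqxx; case: eqP => [?|_]; first lia.
  rewrite eqxx; congr (_ + _); apply: (eval_ext _ _ l0 sc2) => k kl.
  by case: eqP => // ?; lia.
- have [sc1 sc2] := andP sc; have [code1 code2] := code_at_cat code_e.
  have [{}code2 code3] := code_at_cat code2.
  rewrite !hornerE !size_cat !addnA.
  apply: (@reaches_trans _ _ _ ((cost e2).[N]%R + 1) _ _ _ _ _ _ _
    (IH1 _ _ _ _ code1 l0 sc1 n_le repr_m)); last lia.
  move=> m1 repr1.
  have l1 : 0 < l.+1 by [].
  have n_le1 : update env l (eval w env arr e1) 0 <= N.
    by rewrite /update; case: eqP => // ?; lia.
  apply: (reaches_trans (IH2 _ _ _ _ code2 l1 (scoped_leq
    (leqnSn l) sc2) n_le1 repr1)); last exact: leqnn.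
  move=> m2 [rv ra]; apply: (reaches_block code3) => //=.
  split=> [j jl|j]; rewrite /update /=; last first.
    by case: eqP => [?|_]; [lia | apply: ra].
  have [jE|jE] := eqVneq j l; last first.
    case: eqP => [?|_]; first lia.
    rewrite rv ?(leqW jl) // /update (negPf jE); case: eqP => [?|_] //; lia.
  rewrite jE eqxx !rv // /update eqxx; case: eqP => [?|_]; first lia.
  rewrite eqxx; congr (_ - _); apply: (eval_ext _ _ l0 sc2) => k kl.
  by case: eqP => // ?; lia.
- have [code1 code2] := code_at_cat code_e; rewrite !hornerE size_cat addnA.
  apply: (reaches_trans (IHe _ _ _ _ code1 l0 sc n_le repr_m)); last exact: leqnn.
  move=> m1 [rv ra]; apply: (reaches_block code2) => //=.
  split=> [j jl|j]; rewrite /update /=; last first.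
    by case: eqP => [?|_]; [lia | apply: ra].
  have [jE|jE] := eqVneq j l; first by rewrite jE eqxx rv // /update eqxx.
  case: eqP => [?|_]; first lia.
  by rewrite rv // /update (negPf jE).
- have [code1 code2] := code_at_cat code_e; rewrite !hornerE size_cat addnA.
  apply: (reaches_trans (IHe _ _ _ _ code1 l0 sc n_le repr_m)); last exact: leqnn.
  move=> m1 [rv ra]; apply: (reaches_block code2) => //=.
  have rvl : m1 l.*2 = eval w env arr e by rewrite rv // /update eqxx.
  split=> [j jl|j]; rewrite /update /=; last first.
    by do 2 (case: eqP => [?|_]; first lia); apply: ra.
  have [jE|jE] := eqVneq j l.
    rewrite jE !eqxx (_ : (l.*2 == l.+1.*2) = false); last lia.
    rewrite rvl addnn addn1; case: eqP => [?|_]; first lia.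
    by case: eqP => [?|_]; [lia | rewrite ra].
  case: eqP => [?|_]; first lia.
  case: eqP => [?|_]; first lia.
  by rewrite rv // /update (negPf jE).
have [v0l sc1] := andP sc; have {v0l} [v0 vl] := andP v0l.
have [code1 code2] := @code_at_cat p pc [:: Const l.*2 0] _ code_e.
rewrite addn1 in code2; set body := (X in loop _ _ _ X) in code2 *.
pose env' i := update env l (\sum_(j < i) eval w (update env v j) arr e).
have env'v i : env' i v = env v by rewrite /env' /update; case: eqP => // ?; lia.
have env'0 i : env' i 0 = env 0 by rewrite /env' /update; case: eqP => // ?; lia.
have n0 : env 0 * ((cost e).[N]%R + 5) + 10 <= (cost (Sum v e)).[N]%R.
  by rewrite /= !hornerE mulnC leq_add2r leq_mul2l n_le orbT.
apply: (@reaches_trans _ _ 1 (9 + env 0 * (((cost e).[N])%R + 1 + 4)) pc.+1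
  (represents l.+1 (env' 0) arr)); last 1 first.
- by apply: leq_trans n0; lia.
- have [rv ra] := repr_m.
  have -> : pc.+1 = pc + size [:: Const l.*2 0] by rewrite addn1.
  apply: (reaches_block code1) => //=.
  split=> [j jl|j]; rewrite /env' /update /=; last first.
    by case: eqP => [?|_]; [lia | apply: ra].
  have [jE|jE] := eqVneq j l; first by rewrite jE eqxx big_ord0.
  by case: eqP => [?|_]; [lia | apply: rv; lia].
move=> m1 repr1.
have -> : pc + size (code l pc (Sum v e)) = pc.+1 + size (loop l.+1 v pc.+1 body).
  by rewrite addSnnS.
apply: (@loop_reaches p w pc.+1 l.+1 v body (env 0) _ m1 env' (fun=> arr)) => //.
- by rewrite v0 ltnW.
- by move=> i _; rewrite env'v env'0 env'v.
move=> i m2 i_lt repr2.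
have /code_at_cat[_] := code2; rewrite /= -cat1s => /code_at_cat[_].
rewrite /= => /code_at_cat[code3 _].
move: code3; rewrite /body => /code_at_cat[code3 code4].
rewrite size_cat addnA.
have pcE : pc.+1 + 4 + 1 = pc + 6 by lia.
rewrite pcE in code3 code4; rewrite addSnnS.
set env2 := update _ v i in repr2.
have n_le2 : env2 0 <= N.
  by rewrite /env2 /env' /update; do 3 (case: eqP => [?|_]; first lia).
have sc3 : scoped l.+2 e by apply: scoped_leq sc1; lia.
apply: (reaches_trans (IHe _ _ _ _ code3 _ sc3 n_le2 repr2)) => //.
move=> m3 [rv ra]; apply: (reaches_block code4) => //=.
have evE : eval w env2 arr e = eval w (update env v i) arr e.
  apply: (eval_ext _ _ l0 sc1) => k kl; rewrite /env2 /env' /update.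
  by case: eqP => // _; do 2 (case: eqP => [?|_]; first lia).
split=> [j jl|j]; rewrite /update /=; last first.
  by case: eqP => [?|_]; [lia | apply: ra].
have -> : m3 l.+2.*2 = eval w (update env v i) arr e.
  by rewrite rv // /update eqxx evE.
have -> : m3 l.*2 = env2 l.
  rewrite rv; last lia.
  by rewrite /update (_ : (l == l.+2) = false) //; lia.
have [jE|jE] := eqVneq j l; last first.
  case: eqP => [?|_]; first lia.
  rewrite rv; last lia.
  rewrite /update; case: eqP => [?|_]; first lia.
  by rewrite /env2 /env' /update (negPf jE).
have lv : (l == v) = false by lia.
have ll : (l == l.+1) = false by lia.
by rewrite jE eqxx /env2 /env' /update lv ll eqxx big_ord_recr.
Qed.

Inductive command :=
| Skip
| Assign (e1 e2 : expr)
| Seq (c1 c2 : command)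
| For (v : nat) (c : command).

Fixpoint exec (w : bitseq) (env : memory) (c : command) (arr : memory) :
    memory :=
  match c with
  | Skip => arr
  | Assign e1 e2 => update arr (eval w env arr e1) (eval w env arr e2)
  | Seq c1 c2 => exec w env c2 (exec w env c1 arr)
  | For v c =>
    foldl (fun a i => exec w (update env v i) c a) arr (iota 0 (env 0))
  end.

Fixpoint cscoped (l : nat) (c : command) : bool :=
  match c with
  | Skip => true
  | Assign e1 e2 => scoped l e1 && scoped l e2
  | Seq c1 c2 => cscoped l c1 && cscoped l c2
  | For v c => (0 < v < l) && cscoped l c
  end.

Lemma cscoped_leq l l' c : l <= l' -> cscoped l c -> cscoped l' c.
Proof.
move=> le_l; elim: c => //=.
- by move=> e1 e2 /andP[/(scoped_leq le_l)-> /(scoped_leq le_l)->].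
- by move=> c1 IH1 c2 IH2 /andP[/IH1-> /IH2->].
- by move=> v c IHc /andP[/andP[-> /leq_trans->//] /IHc->].
Qed.

Lemma exec_ext w l c env env' arr :
  0 < l -> cscoped l c -> (forall k, k < l -> env k = env' k) ->
  exec w env c arr = exec w env' c arr.
Proof.
move=> l0; elim: c env env' arr => //=.
- move=> e1 e2 env env' arr /andP[s1 s2] E.
  by rewrite (eval_ext w arr l0 s1 E) (eval_ext w arr l0 s2 E).
- move=> c1 IH1 c2 IH2 env env' arr /andP[s1 s2] E.
  by rewrite (IH1 _ _ _ s1 E) (IH2 _ _ _ s2 E).
move=> v c IHc env env' arr /andP[_ s] E; rewrite (E 0 l0).
elim: (iota _ _) arr => //= i s' IHs arr; rewrite -IHs; congr foldl.
by apply: IHc => // k /E; rewrite /update; case: eqP.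
Qed.

Fixpoint ccode (l pc : nat) (c : command) : program :=
  match c with
  | Skip => [::]
  | Assign e1 e2 =>
    let c1 := code l pc e1 in
    c1 ++ code l.+1 (pc + size c1) e2 ++
      [:: Add l.*2 l.*2 l.*2; Const l.+2.*2 1; Add l.*2 l.*2 l.+2.*2;
          StoreInd l.*2 l.+1.*2]
  | Seq c1 c2 => let c1 := ccode l pc c1 in c1 ++ ccode l (pc + size c1) c2
  | For v c => loop l v pc (ccode l.+1 (pc + 5) c)
  end.

Fixpoint ccost (c : command) : {poly nat} :=
  match c with
  | Skip => 0
  | Assign e1 e2 => cost e1 + cost e2 + 4%N%:P
  | Seq c1 c2 => ccost c1 + ccost c2
  | For _ c => (ccost c + 4%N%:P) * 'X + 9%N%:P
  end%R.

Lemma ccode_reaches p w N c l pc m env arr :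
  code_at p pc (ccode l pc c) -> 0 < l -> cscoped l c -> env 0 <= N ->
  represents l env arr m ->
  reaches p w pc m (ccost c).[N]%R (pc + size (ccode l pc c))
    (represents l env (exec w env c arr)).
Proof.
elim: c l pc m env arr => [|e1 e2|c1 IH1 c2 IH2|v c IHc] l pc m env arr
  code_c l0 /= sc n_le repr_m.
- by rewrite addn0; apply: reaches_refl.
- have [sc1 sc2] := andP sc; have [code1 code2] := code_at_cat code_c.
  have [{}code2 code3] := code_at_cat code2.
  rewrite !hornerE !size_cat !addnA.
  apply: (@reaches_trans _ _ _ ((cost e2).[N]%R + 4) _ _ _ _ _ _ _
    (code_reaches _ code1 l0 sc1 n_le repr_m)); last lia.
  move=> m1 repr1.
  have n_le1 : update env l (eval w env arr e1) 0 <= N.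
    by rewrite /update; case: eqP => // ?; lia.
  apply: (reaches_trans (code_reaches w code2 (ltn0Sn l)
    (scoped_leq (leqnSn l) sc2) n_le1 repr1)); last exact: leqnn.
  move=> m2 [rv ra]; apply: (reaches_block code3) => //=.
  have val1 : m2 l.*2 = eval w env arr e1.
    rewrite rv // /update eqxx (_ : (l == l.+1) = false) //; lia.
  have val2 : m2 l.+1.*2 = eval w env arr e2.
    rewrite rv // /update eqxx; apply: (eval_ext _ _ l0 sc2) => k kl.
    by case: eqP => // ?; lia.
  have eqs : [/\ (l.*2 == l.+2.*2) = false, (l.+1.*2 == l.+2.*2) = false
    & (l.+1.*2 == l.*2) = false] by split; lia.
  case: eqs => eq1 eq2 eq3.
  split=> [j jl|j]; rewrite /update ?eqxx ?eq1 ?eqxx ?eq2 ?eq3 ?val1 ?val2.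
    rewrite addnn addn1; case: eqP => [?|_]; first lia.
    have -> : (j.*2 == l.*2) = false by lia.
    have -> : (j.*2 == l.+2.*2) = false by lia.
    rewrite rv; last lia.
    by rewrite /update; do 2 (case: eqP => [?|_]; first lia).
  rewrite addnn addn1 eqSS (inj_eq double_inj); case: eqP => // _.
  have -> : (j.*2.+1 == l.*2) = false by lia.
  have -> : (j.*2.+1 == l.+2.*2) = false by lia.
  exact: ra.
- have [sc1 sc2] := andP sc; have [code1 code2] := code_at_cat code_c.
  rewrite !hornerE !size_cat !addnA.
  by apply: (reaches_trans (IH1 _ _ _ _ _ code1 l0 sc1 n_le repr_m)) => [m1|];
    [apply: IH2 | apply: leqnn].
have [vl sc1] := andP sc; have [v0 v1] := andP vl.
pose arr' i := foldl (fun a i => exec w (update env v i) c a) arr (iota 0 i).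
apply: (@reaches_trans _ _ _ 0 _ _ _ _ _ _ _ (@loop_reaches p w pc l v
  (ccode l.+1 (pc + 5) c) (env 0) (ccost c).[N]%R m (fun=> env) arr'
  _ _ _ _ _)) => //.
- move=> i m1 i_lt repr1.
  have code1 : code_at p (pc + 5) (ccode l.+1 (pc + 5) c).
    have [_] := code_at_cat code_c; rewrite -cat1s => /code_at_cat[_].
    by rewrite /= -addnA => /code_at_cat[].
  set env1 := update _ v i in repr1.
  have n_le1 : env1 0 <= N.
    by rewrite /env1 /update; do 2 (case: eqP => [?|_]; first lia).
  apply: (@reaches_trans _ _ _ 0 _ _ _ _ _ _ _ (IHc _ _ _ _ _ code1 _
    (cscoped_leq (leqnSn l) sc1) n_le1 repr1)) => //.
    move=> m2 repr2; apply: reaches_refl.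
    have -> : arr' i.+1 = exec w env1 c (arr' i); last by [].
    rewrite /arr' -addn1 iotaD foldl_cat /=.
    apply: (exec_ext _ _ l0 sc1) => k kl; rewrite /env1 /update.
    by case: eqP => // _; case: eqP => // ?; lia.
  by rewrite addn0.
- by move=> m2 repr2; apply: reaches_refl.
by rewrite !hornerE; move: (_.[_]%R) => C; nia.
Qed.

(* The prelude computes the length of the leading run of ones. *)
Definition prelude : program :=
  [:: Const 2 1; JumpPos 2 3; Add 0 0 2; Read 4 0; JumpPos 4 2].

Definition decider (l : nat) (c : command) (e : expr) : program :=
  let c1 := ccode l 5 c in
  let c2 := code l (5 + size c1) e in
  prelude ++ c1 ++ c2 ++
    [:: JumpPos l.*2 (5 + size c1 + size c2 + 2); Reject; Accept].

(** The computation is entered at the read instruction: each one costs 3 steps and the final zero 2.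
    Address [0] is that of variable [0], so the count is left where the loops look for it. *)
Lemma prelude_reaches p w n k m :
  code_at p 0 prelude -> m 0 = n -> m 2 = 1 ->
  (forall i, i < k -> nth 2 (map nat_of_bool w) (n + i) = 1) ->
  nth 2 (map nat_of_bool w) (n + k) = 0 ->
  reaches p w 3 m (3 * k + 2) 5
    (fun m' => m' 0 = n + k /\ forall i, m' i.*2.+1 = m i.*2.+1).
Proof.
move=> code_p; elim: k n m => [|k IHk] n m m0 m2 ones zero.
all: have code_read : code_at p 3 [:: Read 4 0] by
  have [p1 [p2 [-> sz1]]] := code_p; move/size0nil: sz1 => ->;
  exists [:: Const 2 1; JumpPos 2 3; Add 0 0 2], (JumpPos 4 2 :: p2).
all: have code_add : code_at p 2 [:: Add 0 0 2] by
  have [p1 [p2 [-> sz1]]] := code_p; move/size0nil: sz1 => ->;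
  exists [:: Const 2 1; JumpPos 2 3], ([:: Read 4 0; JumpPos 4 2] ++ p2).
all: have jmp : onth p 4 = Some (JumpPos 4 2) by
  have [p1 [p2 [-> sz1]]] := code_p; move/size0nil: sz1 => ->.
  apply: (@reaches_trans _ _ 1 1 4 (fun m' => m' 4 = 0 /\
    (m' 0 = n + 0 /\ forall i, m' i.*2.+1 = m i.*2.+1))) => //.
    apply: (reaches_block code_read) => //=.
    rewrite addn0 in zero; rewrite /update /= m0 addn0 zero.
    by split=> //; split=> // i; case: eqP => // ?; lia.
  move=> m1 [m14 rest].
  have := @reaches_jump p w 4 4 2 m1 1 (fun m' => m' 0 = n + 0 /\
    forall i, m' i.*2.+1 = m i.*2.+1) jmp isT rest.
  by rewrite m14.
apply: (@reaches_trans _ _ 1 (3 * k + 4) 4 (fun m' => m' 4 = 1 /\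
  [/\ m' 0 = n, m' 2 = 1 & forall i, m' i.*2.+1 = m i.*2.+1])); last lia.
  apply: (reaches_block code_read) => //=.
  have ones0 := ones 0 isT; rewrite addn0 in ones0.
  rewrite /update /= m0 ones0; do !split=> //.
  by move=> i; case: eqP => // ?; lia.
move=> m1 [m14 rest].
pose inv m' := [/\ m' 0 = n, m' 2 = 1 & forall i, m' i.*2.+1 = m i.*2.+1].
apply: (@reaches_trans _ _ 1 (3 * k + 3) 2 inv); last lia.
  by have := @reaches_jump p w 4 4 2 m1 1 inv jmp isT rest; rewrite m14.
move=> {rest m14} m3 [m30 m32 m3a].
apply: (@reaches_trans _ _ 1 (3 * k + 2) 3 (fun m' =>
  [/\ m' 0 = n.+1, m' 2 = 1 & forall i, m' i.*2.+1 = m i.*2.+1])); last lia.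
  by apply: (reaches_block code_add) => //=; rewrite /update /= m30 m32 addn1;
    split=> // i; rewrite m3a.
move=> m4 [m40 m42 m4a].
have := IHk n.+1 m4 m40 m42.
rewrite addSnnS => H.
have {}H := H _ zero.
apply: (@reaches_trans _ _ _ 0 _ _ _ _ _ _ _ (H _)); last by rewrite addn0.
  by move=> i ik; rewrite addSnnS ones.
by move=> m5 [m50 m5a]; apply: reaches_refl; split=> // i; rewrite m5a m4a.
Qed.

Lemma run_accept p w pc m t : onth p pc = Some Accept ->
  run p w t.+1 pc m = Some true.
Proof. by rewrite /= => ->. Qed.

Lemma run_reject p w pc m t : onth p pc = Some Reject ->
  run p w t.+1 pc m = Some false.
Proof. by rewrite /= => ->. Qed.

Definition decider_time (c : command) (e : expr) : {poly nat} :=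
  (3%N%:P * 'X + ccost c + cost e + 10%N%:P)%R.

Lemma decider_verdict l c e w n :
  0 < l -> cscoped l c -> scoped l e -> n <= size w ->
  (forall i, i < n -> nth 2 (map nat_of_bool w) i = 1) ->
  nth 2 (map nat_of_bool w) n = 0 ->
  exists env, env 0 = n /\
    verdict (decider l c e) w (decider_time c e).[size w]%R =
      Some (0 < eval w env (exec w env c (fun=> 0)) e).
Proof.
move=> l0 scc sce n_le ones zero; set p := decider l c e.
pose c1 := ccode l 5 c; pose c2 := code l (5 + size c1) e.
pose c3 := [:: JumpPos l.*2 (5 + size c1 + size c2 + 2); Reject; Accept].
have pE : p = prelude ++ c1 ++ c2 ++ c3 by [].
have code_p : code_at p 0 p by exists [::], [::]; rewrite cats0.
have [code_pre] := code_at_cat code_p; rewrite add0n => /code_at_cat[code1].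
move=> /code_at_cat[code2 code3].
pose m0 : memory := update (fun=> 0) 2 1.
set T := (decider_time c e).[size w]%R.
have TE : T = 3 * size w + (ccost c).[size w]%R + (cost e).[size w]%R + 10.
  by rewrite /T /decider_time !hornerE.
have : exists env, env 0 = n /\
    reaches p w 0 (fun=> 0) (T - 1) (5 + size c1 + size c2 +
      (if 0 < eval w env (exec w env c (fun=> 0)) e then 2 else 1)) (fun=> True).
  have [t1 [m1 [t1_le [m10 m1a] run1]]] :=
    @prelude_reaches p w 0 n m0 code_pre erefl erefl ones zero.
  (* The prelude leaves its own data in variables [1] and [2], hence an environment known only at
     [0]. *)
  exists (fun k => m1 k.*2); split=> //.
  apply: (@reaches_trans _ _ 2 (T - 3) 3 (fun m => m = m0)); last lia.
    by exists 2, m0; split.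
  move=> m ->.
  apply: (@reaches_trans _ _ (3 * n + 2) (T - 5 - 3 * n) 5 (fun m => m = m1)); last lia.
    by exists t1, m1; split.
  move=> {m} m ->.
  have repr1 : represents l (fun k => m1 k.*2) (fun=> 0) m1.
    by split=> // i; rewrite m1a /m0 /update; case: eqP => // ?; lia.
  have n_le' : m1 0 <= size w by rewrite m10.
  apply: (@reaches_trans _ _ _ ((cost e).[size w]%R + 1) _ _ _ _ _ _ _
    (ccode_reaches w code1 l0 scc n_le' repr1)); last lia.
  move=> m2 repr2.
  apply: (@reaches_trans _ _ _ 1 _ _ _ _ _ _ _
    (code_reaches w code2 l0 sce n_le' repr2)); last lia.
  move=> m3 [rv _].
  have := @reaches_jump p w _ _ _ m3 1 (fun=> True) (code_at_head code3) isT I.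
  rewrite rv // /update eqxx.
  by case: ifP => _; rewrite ?addn1.
case=> en [en0 [t [m' [t_le _ run_t]]]]; exists en; split=> //.
rewrite /verdict -/p -/T.
(* The bound [T - 1] keeps one step for the instruction that gives the verdict. *)
have -> : T = t + (T - t.+1).+1 by lia.
rewrite run_t; move: code3; rewrite /= => code3.
case: ifP => _.
  apply: run_accept.
  by have [_ /code_at_head] := @code_at_cat p _ [:: _; _] [:: Accept] code3.
apply: run_reject.
by have [_ /code_at_head] := @code_at_cat p _ [:: _] [:: Reject; Accept] code3.
Qed.

(** * The algorithm *)

Section Saturation.
Variables (W : finType) (H : signed_graph W).
Variables (V : finType) (G : signed_graph V) (L : V -> {set W}).
Local Notation D := (W * bool)%type.
Local Notation T := (V * V * D * D)%type.

(** Members of [C] are tuples already ruled out; the second alternative says that no value at [z]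
    supports the pair any more. *)
Definition fires (x y z : V) (a b : D) (C : {set T}) : bool :=
  refuted H G L x y a b ||
  [forall c, ((x, z, a, c) \in C) || ((z, y, c, b) \in C)].

Lemma fires_subset x y z a b (C C' : {set T}) : C \subset C' ->
  fires x y z a b C -> fires x y z a b C'.
Proof.
move=> /subsetP sub /orP[r|/forallP all_c]; rewrite /fires ?r //.
by apply/orP; right; apply/forallP => c; case/orP: (all_c c) => /sub->;
  rewrite ?orbT.
Qed.

(** [J] singles out the rules carried out so far, so that closure can be collected piece by piece
    along a round. *)
Definition closed_for (J : V -> V -> V -> D -> D -> Prop) (C : {set T}) : Prop :=
  forall x y z a b, J x y z a b -> fires x y z a b C -> (x, y, a, b) \in C.

Definition closed_all (C : {set T}) : Prop := closed_for (fun _ _ _ _ _ => True) C.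

Definition position (t : T) : nat :=
  let: (x, y, a, b) := t in
  #|{: D * D}| * (#|V| * enum_rank x + enum_rank y) + enum_rank (a, b).

Lemma position_inj : injective position.
Proof.
have divmod m q r q' r' : r < m -> r' < m ->
    m * q + r = m * q' + r' -> q = q' /\ r = r'.
  move=> rm rm' E; have m0 : 0 < m by apply: leq_ltn_trans rm.
  have Er : r = r'.
    by have := congr1 (modn^~ m) E; rewrite ![m * _]mulnC !modnMDl !modn_small.
  split=> //; move: E; rewrite Er => /addIn/eqP.
  by rewrite eqn_mul2l (gtn_eqF m0) => /eqP.
move=> [[[x y] a] b] [[[x' y'] a'] b'] /divmod[] // /divmod[] //.
move=> /ord_inj/enum_rank_inj-> /ord_inj/enum_rank_inj->.
by move=> /ord_inj/enum_rank_inj[-> ->].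
Qed.

Definition marked (arr : memory) : {set T} := [set t | 0 < arr (position t)].

(** The second clause gives soundness, since the tuples agreeing with a solution are the complement
    of a closed set. The third recognises a fixpoint. *)
Definition saturates (F : memory -> memory) (J : V -> V -> V -> D -> D -> Prop) :
    Prop := forall arr,
  [/\ marked arr \subset marked (F arr),
      forall C, closed_all C -> marked arr \subset C -> marked (F arr) \subset C
    & marked (F arr) = marked arr -> closed_for J (marked arr)].

Lemma saturates_id : saturates id (fun _ _ _ _ _ => False).
Proof. by move=> arr; split=> // _ x y z a b []. Qed.

Lemma saturates_comp F1 F2 J1 J2 : saturates F1 J1 -> saturates F2 J2 ->
  saturates (fun arr => F2 (F1 arr))
    (fun x y z a b => J1 x y z a b \/ J2 x y z a b).
Proof.
move=> s1 s2 arr; have [inc1 sub1 cl1] := s1 arr.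
have [inc2 sub2 cl2] := s2 (F1 arr); split.
- exact: subset_trans inc1 inc2.
- by move=> C clC sC; apply: sub2 => //; apply: sub1.
(* Marks only accumulate, so no change overall means no change at the intermediate stage. *)
move=> E; have E1 : marked (F1 arr) = marked arr.
  by apply/eqP; rewrite eqEsubset inc1 andbT -E inc2.
move=> x y z a b [J|J]; first exact: cl1.
by rewrite -E1; apply: cl2; rewrite // E E1.
Qed.

Lemma saturates_foldl (I : eqType) (F : I -> memory -> memory) J (s : seq I) :
  (forall i, i \in s -> saturates (F i) (J i)) ->
  saturates (fun arr => foldl (fun a i => F i a) arr s)
    (fun x y z a b => exists2 i, i \in s & J i x y z a b).
Proof.
elim: s => [|i s IHs] sat.
  move=> arr; have [inc sub cl] := saturates_id arr; split=> // _ x y z a b.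
  by case.
have sat_s := IHs (fun j js => sat j (@mem_behead _ (i :: s) j js)).
move=> arr; have [inc sub cl] :=
  saturates_comp (sat i (mem_head i s)) sat_s arr.
split=> // E x y z a b [j]; rewrite inE => /orP[/eqP->|js] Jj.
  by apply: (cl E); left.
by apply: (cl E); right; exists j.
Qed.

(* A round that marks nothing new starts from a closed set, so as many rounds as
   there are tuples always end in one. *)
Definition progresses (k : nat) (F : memory -> memory) : Prop := forall arr,
  [/\ marked arr \subset marked (F arr),
      forall C, closed_all C -> marked arr \subset C -> marked (F arr) \subset C
    & closed_all (marked (F arr)) \/
      k + #|marked arr| <= #|marked (F arr)|].

Lemma progresses_saturates F : saturates F (fun _ _ _ _ _ => True) ->
  progresses 1 F.
Proof.
move=> sat arr; have [inc sub cl] := sat arr; split=> //.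
have [E|neq] := eqVneq (marked (F arr)) (marked arr).
  by left; rewrite E; apply: cl.
by right; rewrite add1n; apply: proper_card; rewrite properEneq eq_sym neq.
Qed.

Lemma progresses_comp k1 k2 F1 F2 : progresses k1 F1 -> progresses k2 F2 ->
  progresses (k1 + k2) (fun arr => F2 (F1 arr)).
Proof.
move=> p1 p2 arr; have [inc1 sub1 cl1] := p1 arr.
have [inc2 sub2 cl2] := p2 (F1 arr); split.
- exact: subset_trans inc1 inc2.
- by move=> C clC sC; apply: sub2 => //; apply: sub1.
case: cl1 => [cl1|le1].
  (* A closed set is a bound for what [F2] can mark when started from it. *)
  left; have E : marked (F2 (F1 arr)) = marked (F1 arr).
    by apply/eqP; rewrite eqEsubset inc2 andbT; apply: sub2.
  by rewrite E.
by case: cl2 => [cl2|le2]; [left | right; lia].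
Qed.

Lemma progresses_foldl k (F : nat -> memory -> memory) s :
  (forall i, progresses k (F i)) ->
  progresses (size s * k) (fun arr => foldl (fun a i => F i a) arr s).
Proof.
move=> pF; elim: s => [|i s IHs]; last exact: (progresses_comp (pF i) IHs).
by move=> arr; split=> //; right.
Qed.

Lemma progresses_closed k F arr : progresses k F -> #|{: T}| <= k ->
  closed_all (marked (F arr)).
Proof.
move=> pF le_k; have [_ _ [//|le]] := pF arr.
(* Otherwise as many tuples are marked as there are, and the full set is closed. *)
suff -> : marked (F arr) = setT by move=> x y z a b _ _; rewrite inE.
apply/eqP; rewrite eqEcard subsetT cardsT.
by apply: leq_trans le_k _; apply: leq_trans le; apply: leq_addr.
Qed.

End Saturation.

(** * Reading the instance off the bit string *)

Section Encoding.
Variables (W : finType) (x : instance W).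
Let V := inst_vertices x.
Let G := inst_graph x.
Let w := encode_instance x.
Let bits := map nat_of_bool w.

Lemma nth_allpairs (S T R : Type) (f : S -> T -> R) d a0 b0 s t i j :
  i < size s -> j < size t ->
  nth d [seq f a b | a <- s, b <- t] (size t * i + j) =
    f (nth a0 s i) (nth b0 t j).
Proof.
move=> + jt; elim: s i => [|a s IHs] [|i] //= i_lt; rewrite nth_cat size_map.
  by rewrite muln0 add0n jt (nth_map b0).
by rewrite mulnS -addnA ltnNge leq_addr /= addKn IHs.
Qed.

Lemma nth_shift (R : Type) d (s1 s2 : seq R) i :
  nth d (s1 ++ s2) (size s1 + i) = nth d s2 i.
Proof. by rewrite nth_cat ltnNge leq_addr /= addKn. Qed.

Lemma bits_E i : nth 2 bits i = if i < size w then nat_of_bool (nth false w i) else 2.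
Proof.
rewrite /bits; case: ltnP => i_lt; first exact: nth_map.
by rewrite nth_default ?size_map.
Qed.

(** This makes the size of the input an admissible argument for the cost polynomials. *)
Lemma card_le_size : #|V| <= size w.
Proof. by rewrite size_cat size_nseq leq_addr. Qed.

Lemma bits_ones i : i < #|V| -> nth 2 bits i = 1.
Proof.
move=> i_lt; rewrite bits_E (leq_trans i_lt card_le_size).
by rewrite nth_cat size_nseq i_lt nth_nseq i_lt.
Qed.

Lemma bits_zero : nth 2 bits #|V| = 0.
Proof.
have [q wE] : exists q, w = nseq #|V| true ++ false :: q by eexists.
by rewrite bits_E wE size_cat size_nseq nth_cat size_nseq ltnn subnn /= addnS ltnS leq_addr.
Qed.

Lemma rank_lt (T : finType) (u : T) : enum_rank u < size (enum T).
Proof. by rewrite -cardT. Qed.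

Lemma bits_pair (R S : finType) (f : R -> S -> bool) p q (a : R) (b : S) :
  w = p ++ [seq f a b | a <- enum R, b <- enum S] ++ q ->
  nth 2 bits (size p + (#|S| * enum_rank a + enum_rank b)) = f a b.
Proof.
move=> wE; rewrite bits_E wE !size_cat size_allpairs -!cardT ltn_add2l nth_shift.
have lt_k : #|S| * enum_rank a + enum_rank b < #|R| * #|S|.
  rewrite [ltnRHS]mulnC; apply: (@leq_trans (#|S| * (enum_rank a).+1)).
    by rewrite mulnS [ltnRHS]addnC ltn_add2l ltn_ord.
  by rewrite leq_mul2l ltn_ord orbT.
rewrite ltn_addr // nth_cat size_allpairs -!cardT lt_k.
have := nth_allpairs f false a b (rank_lt a) (rank_lt b).
by rewrite -cardT => ->; rewrite !nth_enum_rank.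
Qed.

Lemma bits_blue a b :
  nth 2 bits (#|V| + 1 + (#|V| * enum_rank a + enum_rank b)) = blue G a b.
Proof.
rewrite -(bits_pair (f := blue G) (p := nseq #|V| true ++ [:: false])
  (q := [seq red G a b | a <- enum V, b <- enum V]
    ++ [seq c \in inst_lists a | a <- enum V, c <- enum W])).
  by rewrite size_cat size_nseq.
by rewrite -!catA.
Qed.

Lemma bits_red a b :
  nth 2 bits (#|V| + 1 + (#|V| * #|V| + (#|V| * enum_rank a + enum_rank b))) =
    red G a b.
Proof.
rewrite -(bits_pair (f := red G) (p := nseq #|V| true ++ [:: false] ++
    [seq blue G a b | a <- enum V, b <- enum V])
  (q := [seq c \in inst_lists a | a <- enum V, c <- enum W])).
  by rewrite !size_cat size_nseq size_allpairs -!cardT !addnA.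
by rewrite -!catA.
Qed.

Lemma bits_list a c :
  nth 2 bits (#|V| + 1 + (#|V| * #|V| + #|V| * #|V| +
    (#|W| * enum_rank a + enum_rank c))) = (c \in inst_lists (i := x) a).
Proof.
rewrite -(bits_pair (f := fun a c => c \in inst_lists (i := x) a)
  (p := nseq #|V| true ++ [:: false] ++
    [seq blue G a b | a <- enum V, b <- enum V] ++
    [seq red G a b | a <- enum V, b <- enum V]) (q := [::])).
  by rewrite !size_cat size_nseq !size_allpairs -!cardT !addnA.
by rewrite -!catA cats0.
Qed.

End Encoding.

Definition scale (e : expr) : expr := Sum 4 e.
Definition times (c : nat) (e : expr) : expr := iter c (Plus e) (Lit 0).
Definition total (es : seq expr) : expr := foldr Plus (Lit 0) es.
Definition negate (e : expr) : expr := Minus (Lit 1) e.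
Definition sequence (cs : seq command) : command := foldr Seq Skip cs.

Lemma scoped_times l c e : scoped l e -> scoped l (times c e).
Proof. by move=> sc; elim: c => //= c ->; rewrite sc. Qed.

Lemma scoped_total l es : scoped l (total es) = all (scoped l) es.
Proof. by elim: es => //= e es ->. Qed.

Lemma cscoped_sequence l cs : cscoped l (sequence cs) = all (cscoped l) cs.
Proof. by elim: cs => //= c cs ->. Qed.

Section Evaluation.
Variables (w : bitseq) (env arr : memory).
Local Notation ev := (eval w env arr).

Lemma eval_scale e : scoped 4 e -> ev (scale e) = env 0 * ev e.
Proof.
move=> sc; rewrite /= -[env 0 in RHS]card_ord -sum_nat_const.
by apply: eq_bigr => i _; apply: (eval_ext _ _ _ sc) => // k;
  rewrite /update; case: eqP => // ->.
Qed.

Lemma eval_times c e : ev (times c e) = c * ev e.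
Proof. by elim: c => //= c ->. Qed.

Lemma eval_total_gt0 es : (0 < ev (total es)) = has (fun e => 0 < ev e) es.
Proof. by elim: es => //= e es IHes; rewrite addn_gt0 IHes. Qed.

Lemma eval_negate_gt0 e : (0 < ev (negate e)) = ~~ (0 < ev e).
Proof. by rewrite /= subn_gt0 ltnS -leqNgt. Qed.

End Evaluation.

(** * Path consistency as a program *)

Section Algorithm.
Variables (W : finType) (H : signed_graph W).
Local Notation D := (W * bool)%type.

(* Variables 1, 2, 3 hold the vertices [x], [y], [z] of a rule; [scale], which
   multiplies by the number of vertices, uses 4. *)
Definition pair_index (i j : nat) : expr := Plus (scale (Var i)) (Var j).
Definition after_header (e : expr) : expr := Bit (Plus (Plus (Var 0) (Lit 1)) e).
Definition blue_bit (i j : nat) : expr := after_header (pair_index i j).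
Definition red_bit (i j : nat) : expr :=
  after_header (Plus (scale (Var 0)) (pair_index i j)).
Definition list_bit (i : nat) (c : W) : expr :=
  after_header (Plus (Plus (scale (Var 0)) (scale (Var 0)))
    (Plus (times #|W| (Var i)) (Lit (enum_rank c)))).
Definition cell_index (i j : nat) (a b : D) : expr :=
  Plus (times #|{: D * D}| (pair_index i j)) (Lit (enum_rank (a, b))).
Definition mark (i j : nat) (a b : D) : expr := Cell (cell_index i j a b).

(** Truth is positivity and disjunction is a sum. Conditions on [H] and on the values are decided
    while the program is built, and only the instance is inspected at run time. The two truncated
    differences vanish together exactly when the vertices coincide. *)
Definition refuted_expr (a b : D) : expr := total
  [:: negate (list_bit 1 a.1); negate (list_bit 2 b.1);
      if a == b then Lit 0 else
        negate (Plus (Minus (Var 1) (Var 2)) (Minus (Var 2) (Var 1)));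
      if respects H a b true then Lit 0 else blue_bit 1 2;
      if respects H a b false then Lit 0 else red_bit 1 2].

Definition path_expr (a b : D) : expr :=
  negate (total [seq negate (Plus (mark 1 3 a c) (mark 3 2 c b)) | c <- enum {: D}]).

Definition apply_rule (ab : D * D) : command :=
  let: (a, b) := ab in
  Assign (cell_index 1 2 a b)
    (Plus (mark 1 2 a b) (Plus (refuted_expr a b) (path_expr a b))).

Definition round : command :=
  For 1 (For 2 (For 3 (sequence [seq apply_rule ab | ab <- enum {: D * D}]))).

(** The number of rounds is that of tuples of two vertices and two values. Both loops merely count,
    so variable [1] can be shared with [round]. *)
Definition propagate : command :=
  For 1 (For 1 (sequence (nseq #|{: D * D}| round))).

Definition unrefuted : expr :=
  negate (Sum 1 (negate (total [seq negate (mark 1 1 a a) | a <- enum {: D}]))).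

Lemma scoped_pair_index i j : i < 5 -> j < 5 -> scoped 5 (pair_index i j).
Proof. by move=> i5 j5; rewrite /= i5 j5. Qed.

Lemma scoped_mark i j a b : i < 5 -> j < 5 -> scoped 5 (mark i j a b).
Proof.
by move=> i5 j5; rewrite /= andbT; apply/scoped_times/scoped_pair_index.
Qed.

Lemma scoped_list_bit i c : i < 5 -> scoped 5 (list_bit i c).
Proof. by move=> i5; rewrite /= andbT; apply: scoped_times. Qed.

Lemma scoped_apply_rule ab : cscoped 5 (apply_rule ab).
Proof.
case: ab => a b; rewrite /apply_rule; cbn [cscoped scoped].
rewrite -/(scoped 5 (Cell _)) -/(mark 1 2 a b) scoped_mark //.
rewrite [scoped 5 (cell_index _ _ _ _)](scoped_mark a b (i := 1) (j := 2)) //.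
rewrite /refuted_expr /path_expr /negate; cbn [scoped].
rewrite !scoped_total; cbn [all scoped]; rewrite !scoped_list_bit // !andTb.
apply/andP; split; first by case: eqP; do 2 case: respects.
rewrite all_map; apply/allP => c _.
change (scoped 5 (mark 1 3 a c) && scoped 5 (mark 3 2 c b)).
by rewrite !scoped_mark.
Qed.

Lemma scoped_propagate : cscoped 5 propagate.
Proof.
rewrite /propagate /round; cbn [cscoped]; rewrite cscoped_sequence !andTb.
rewrite all_nseq; apply/orP; right; cbn [cscoped]; rewrite cscoped_sequence !andTb.
by rewrite all_map; apply/allP => ab _; apply: scoped_apply_rule.
Qed.

Lemma scoped_unrefuted : scoped 5 unrefuted.
Proof.
rewrite /unrefuted /negate; cbn [scoped]; rewrite !andTb scoped_total all_map.
by apply/allP => a _; change (scoped 5 (mark 1 1 a a)); rewrite scoped_mark.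
Qed.

Variable x : instance W.
Let V := inst_vertices x.
Let G := inst_graph x.
Let L := @inst_lists W x.
Let w := encode_instance x.
Let mrk := @marked W V.

Section Rule.
Variables (env arr : memory).
Hypothesis env0 : env 0 = #|V|.

Lemma eval_pair_index i j (u v : V) : i < 4 ->
  env i = enum_rank u -> env j = enum_rank v ->
  eval w env arr (pair_index i j) = #|V| * enum_rank (u : V) + enum_rank (v : V).
Proof.
by move=> i4 <- <-; rewrite /pair_index; cbn [eval]; rewrite eval_scale // env0.
Qed.

Lemma eval_blue_bit i j (u v : V) : i < 4 ->
  env i = enum_rank u -> env j = enum_rank v ->
  eval w env arr (blue_bit i j) = blue G u v.
Proof.
move=> i4 ui vj; rewrite /blue_bit /after_header; cbn [eval].
by rewrite (eval_pair_index i4 ui vj) env0 bits_blue.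
Qed.

Lemma eval_red_bit i j (u v : V) : i < 4 ->
  env i = enum_rank u -> env j = enum_rank v ->
  eval w env arr (red_bit i j) = red G u v.
Proof.
move=> i4 ui vj; rewrite /red_bit /after_header; cbn [eval].
by rewrite (eval_pair_index i4 ui vj) eval_scale // /= env0 bits_red.
Qed.

Lemma eval_list_bit i c (u : V) : env i = enum_rank u ->
  eval w env arr (list_bit i c) = (c \in L u).
Proof.
move=> ui; rewrite /list_bit /after_header; cbn [eval].
by rewrite !eval_scale // eval_times; cbn [eval]; rewrite ui env0 bits_list.
Qed.

Lemma eval_cell_index i j (u v : V) a b : i < 4 ->
  env i = enum_rank u -> env j = enum_rank v ->
  eval w env arr (cell_index i j a b) = position (u, v, a, b).
Proof.
move=> i4 ui vj; rewrite /cell_index; cbn [eval].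
by rewrite eval_times (eval_pair_index i4 ui vj).
Qed.

Lemma eval_mark i j (u v : V) a b : i < 4 ->
  env i = enum_rank u -> env j = enum_rank v ->
  (0 < eval w env arr (mark i j a b)) = ((u, v, a, b) \in mrk arr).
Proof.
move=> i4 ui vj; rewrite /mark; cbn [eval].
by rewrite (eval_cell_index a b i4 ui vj) inE.
Qed.

Variables u v z : V.
Hypotheses (env1 : env 1 = enum_rank u) (env2 : env 2 = enum_rank v).
Hypothesis env3 : env 3 = enum_rank z.

Lemma eval_refuted a b :
  (0 < eval w env arr (refuted_expr a b)) = refuted H G L u v a b.
Proof.
rewrite /refuted_expr eval_total_gt0; cbn [has].
rewrite !eval_negate_gt0 (eval_list_bit _ env1) (eval_list_bit _ env2) !lt0b.
congr [|| _, _ | _]; congr (_ || _).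
  have [ab|ab] := eqVneq a b; first by rewrite andbF.
  rewrite eval_negate_gt0 /= env1 env2 andbT.
  have -> : (u == v) = (enum_rank u == enum_rank v :> nat).
    by apply/eqP/eqP => [->|/ord_inj/enum_rank_inj].
  lia.
rewrite orbF /allowed negb_and !negb_imply.
congr (_ || _); case: respects; rewrite ?andbF ?andbT //.
  by rewrite (eval_blue_bit _ env1 env2) // lt0b.
by rewrite (eval_red_bit _ env1 env2) // lt0b.
Qed.

Lemma eval_path a b : (0 < eval w env arr (path_expr a b)) =
  [forall c, ((u, z, a, c) \in mrk arr) || ((z, v, c, b) \in mrk arr)].
Proof.
rewrite /path_expr eval_negate_gt0 eval_total_gt0 has_map -all_predC.
rewrite (eq_all (a2 := fun c => ((u, z, a, c) \in mrk arr) ||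
  ((z, v, c, b) \in mrk arr))).
  by apply/allP/forallP => all_c c; [apply: all_c; rewrite mem_enum | move=> _].
move=> c.
change (~~ (0 < eval w env arr (negate (Plus (mark 1 3 a c) (mark 3 2 c b)))) =
  ((u, z, a, c) \in mrk arr) || ((z, v, c, b) \in mrk arr)).
rewrite eval_negate_gt0 negbK; cbn [eval]; rewrite addn_gt0.
by rewrite (eval_mark _ _ _ env1 env3) // (eval_mark _ _ _ env3 env2).
Qed.

Lemma marked_rule a b :
  mrk (exec w env (apply_rule (a, b)) arr) =
    if fires H G L u v z a b (mrk arr) then (u, v, a, b) |: mrk arr else mrk arr.
Proof.
rewrite /apply_rule; cbn [exec]; rewrite (eval_cell_index a b _ env1 env2) //.
set e := Plus _ _.
have eE : (0 < eval w env arr e) =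
    ((u, v, a, b) \in mrk arr) || fires H G L u v z a b (mrk arr).
  rewrite (_ : eval w env arr e = eval w env arr (mark 1 2 a b) +
    (eval w env arr (refuted_expr a b) + eval w env arr (path_expr a b))) //.
  rewrite (addn_gt0 (eval w env arr (mark _ _ _ _))).
  rewrite (addn_gt0 (eval w env arr (refuted_expr _ _))).
  by rewrite eval_refuted eval_path (eval_mark _ _ _ env1 env2).
apply/setP => t; rewrite inE /update (inj_eq (@position_inj W V)).
have [->|neq] := eqVneq t (u, v, a, b).
  by rewrite eE; case: ifP => _; rewrite ?orbT ?orbF // !inE eqxx.
by case: ifP => _; rewrite ?inE ?(negPf neq).
Qed.

End Rule.

Lemma saturates_rule env u v z a b : env 0 = #|V| -> env 1 = enum_rank u ->
  env 2 = enum_rank v -> env 3 = enum_rank z ->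
  saturates H G L (exec w env (apply_rule (a, b)))
    (fun u' v' z' a' b' => (u', v', z', a', b') = (u, v, z, a, b)).
Proof.
move=> env0 env1 env2 env3 arr.
have E := marked_rule arr env0 env1 env2 env3 a b; rewrite /mrk in E; split.
- by rewrite E; case: ifP => // _; apply: subsetUr.
- move=> C clC sC; rewrite E; case: ifP => // fire.
  by rewrite subUset sub1set sC andbT; apply: clC I (fires_subset sC fire).
move=> E1 u' v' z' a' b' [-> -> -> -> ->] fire.
by rewrite -E1 E fire !inE eqxx.
Qed.

Lemma saturates_weaken F (J J' : V -> V -> V -> D -> D -> Prop) :
  (forall u v z a b, J' u v z a b -> J u v z a b) ->
  saturates H G L F J -> saturates H G L F J'.
Proof.
move=> JJ sat arr; have [inc sub cl] := sat arr; split=> // E u v z a b /JJ.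
exact: cl.
Qed.

Lemma saturates_For env n c (J : V -> V -> V -> V -> D -> D -> Prop) :
  env 0 = #|V| ->
  (forall t, saturates H G L (exec w (update env n (enum_rank t)) c) (J t)) ->
  saturates H G L (exec w env (For n c))
    (fun u v z a b => exists t, J t u v z a b).
Proof.
move=> env0 sat.
apply: (@saturates_weaken _ (fun u v z a b => exists2 i, i \in iota 0 (env 0) &
  exists2 t : V, i = enum_rank t & J t u v z a b)).
  move=> u v z a b [t Jt]; exists (nat_of_ord (enum_rank t)); last by exists t.
  by rewrite mem_iota env0 ltn_ord.
apply: saturates_foldl => i; rewrite mem_iota env0 /= add0n => i_lt.
pose t : V := enum_val (Ordinal i_lt).
have it : i = enum_rank t by rewrite /t enum_valK.
rewrite {1}it; apply: saturates_weaken (sat t) => u v z a b [t'].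
by rewrite it => /ord_inj/enum_rank_inj->.
Qed.

Lemma exec_sequence (I : Type) (f : I -> command) s env arr :
  exec w env (sequence [seq f i | i <- s]) arr =
    foldl (fun a i => exec w env (f i) a) arr s.
Proof. by elim: s arr => //= i s IHs arr. Qed.

Lemma saturates_round env : env 0 = #|V| ->
  saturates H G L (exec w env round) (fun _ _ _ _ _ => True).
Proof.
move=> env0.
pose J (u v z u' v' z' : V) (a b : D) := (u', v', z') = (u, v, z).
apply: (@saturates_weaken _ (fun u' v' z' a b =>
  exists u v z, J u v z u' v' z' a b)).
  by move=> u v z a b _; exists u, v, z.
apply: saturates_For => // u; apply: saturates_For => // v.
apply: saturates_For => // z; set env' := update _ 3 _.
apply: (@saturates_weaken _ (fun u' v' z' a' b' =>
  exists2 ab, ab \in enum {: D * D} &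
    (u', v', z', a', b') = (u, v, z, ab.1, ab.2))).
  by move=> u' v' z' a b [-> -> ->]; exists (a, b); rewrite ?mem_enum.
move=> arr; rewrite exec_sequence.
apply: (saturates_foldl (F := fun ab => exec w env' (apply_rule ab))
  (J := fun ab u' v' z' a' b' => (u', v', z', a', b') = (u, v, z, ab.1, ab.2))).
by case=> a b _; apply: saturates_rule.
Qed.

Lemma progresses_For env n c k :
  (forall i, progresses H G L k (exec w (update env n i) c)) ->
  progresses H G L (env 0 * k) (exec w env (For n c)).
Proof.
by move=> pc; rewrite -{1}[env 0](size_iota 0); apply: progresses_foldl.
Qed.

Lemma progresses_propagate env : env 0 = #|V| ->
  progresses H G L (#|V| * (#|V| * #|{: D * D}|)) (exec w env propagate).
Proof.
move=> env0; rewrite -[in X in X * _]env0; apply: progresses_For => i.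
have -> : #|V| = update env 1 i 0 by [].
apply: progresses_For => j; set env' := update _ 1 j.
elim: #|{: D * D}| => [|k IHk]; first by move=> arr; split=> //; right.
apply: (progresses_comp (k1 := 1)) IHk.
exact/progresses_saturates/saturates_round.
Qed.

Lemma unrefuted_gt0 env arr : env 0 = #|V| ->
  reflect (forall u : V, exists a, (u, u, a, a) \notin mrk arr)
    (0 < eval w env arr unrefuted).
Proof.
move=> env0; rewrite /unrefuted eval_negate_gt0; cbn [eval].
rewrite -eqn0Ngt sum_nat_eq0.
have cellE (u : V) : (eval w (update env 1 (enum_rank u)) arr
    (negate (total [seq negate (mark 1 1 a a) | a <- enum {: D}])) == 0) =
    [exists a, (u, u, a, a) \notin mrk arr].
  rewrite eqn0Ngt eval_negate_gt0 negbK eval_total_gt0 has_map.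
  rewrite (eq_has (a2 := fun a => (u, u, a, a) \notin mrk arr)).
    by apply/hasP/existsP => [[a _ Ka]|[a Ka]]; exists a; rewrite ?mem_enum.
  move=> a; change ((0 < eval w (update env 1 (enum_rank u)) arr
    (negate (mark 1 1 a a))) = ((u, u, a, a) \notin mrk arr)).
  by rewrite eval_negate_gt0 (@eval_mark (update env 1 (enum_rank u)) arr env0
    1 1 u u a a isT erefl erefl).
apply: (iffP forallP) => [all_u u|all_u i].
  have := all_u (cast_ord (esym env0) (enum_rank u)).
  by move=> /= ; rewrite cellE => /existsP.
apply/implyP => _; have /existsP := all_u (enum_val (cast_ord env0 i)).
by rewrite -cellE enum_valK.
Qed.

End Algorithm.

(** * Sequences of switchings as sets of switched vertices *)

Section Switching.
Variables (V : finType).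

(** Each switching at one end of an edge swaps its colours, so only parities matter. At a loop the
    two parities cancel, in keeping with [flipped]. *)
Lemma switch_colours (G : signed_graph V) (s : seq V) x y :
  let odd_at := odd (count_mem x s) (+) odd (count_mem y s) in
  blue (foldl (@switch V) G s) x y = (if odd_at then red G x y else blue G x y) /\
  red (foldl (@switch V) G s) x y = (if odd_at then blue G x y else red G x y).
Proof.
elim: s G => //= v s IHs G; have [-> ->] := IHs (switch G v).
rewrite /= /switch_blue /switch_red !oddD.
have -> : flipped v x y = odd (v == x) (+) odd (v == y).
  rewrite /flipped ![v == _]eq_sym !oddb.
  have [->|xy] := eqVneq x y; first by rewrite addbb.
  by case: (eqVneq x v) xy => [->|_] xy; rewrite 1?eq_sym ?(negPf xy).
rewrite addbACA; case: (odd (v == x) (+) _) => //=.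
by case: (odd _ (+) odd _).
Qed.

Lemma sg_homP (W : finType) (G : signed_graph V) (H : signed_graph W) f :
  sg_hom G H f <-> exists s : V -> bool,
    forall x y, allowed H G x y (f x, s x) (f y, s y).
Proof.
split=> [[G' [[s ->] [fb fr]]]|[s al]].
  exists (fun x => odd (count_mem x s)) => x y.
  have [Eb Er] := switch_colours G s x y.
  move: (fb x y) (fr x y); rewrite Eb Er /allowed /respects /=.
  case: (odd _); case: (odd _) => /= imb imr; apply/andP;
    by split; apply/implyP.
exists (foldl (@switch V) G [seq x <- enum V | s x]); split.
  by exists [seq x <- enum V | s x].
have cnt x : odd (count_mem x [seq x <- enum V | s x]) = s x.
  have u_s : uniq [seq x <- enum V | s x] by rewrite filter_uniq ?enum_uniq.
  by rewrite (count_uniq_mem _ u_s) mem_filter mem_enum andbT oddb.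
split=> x y; have [Eb Er] := switch_colours G [seq x <- enum V | s x] x y;
  rewrite ?Eb ?Er !cnt; have := al x y; rewrite /allowed /respects /=;
  case: (s x); case: (s y) => /= /andP[/implyP alb /implyP alr];
  by [exact: alb | exact: alr].
Qed.

End Switching.

(** * Correctness and running time of the decision procedure *)

Section Decision.
Variables (W : finType) (H : signed_graph W).
Variables (side : pred W) (r : W -> nat) (sigma : W -> bool).
Hypothesis bip : forall x y, edge H x y -> side x != side y.
Hypothesis r_inj : forall x y, side x = side y -> r x = r y -> x = y.
Hypothesis min_r : forall x x' y y', side x = side x' ->
  r x < r x' -> r y < r y' -> edge H x y' -> edge H x' y -> edge H x y.
Hypothesis special_r : forall x u w,
  bicoloured H x u -> unicoloured H x w -> r u < r w.
Hypothesis deg_uni : forall x a b c, unicoloured H x a -> unicoloured H x b ->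
  unicoloured H x c -> [|| a == b, b == c | a == c].
Hypothesis balanced : forall x y, unicoloured H x y ->
  blue H x y = (sigma x == sigma y).

Lemma decision_correct (x : instance W) env : env 0 = #|inst_vertices x| ->
  let w := encode_instance x in
  0 < eval w env (exec w env (propagate H) (fun=> 0)) (unrefuted W) <->
  list_s_hom H x.
Proof.
move=> env0 w; set arr := exec w env _ _.
pose G := inst_graph x; pose L := @inst_lists W x.
have prog := progresses_propagate H env0.
have [_ least _] := prog (fun=> 0); rewrite -/arr in least.
have closed : closed_all H G L (marked W (inst_vertices x) arr).
  apply: progresses_closed prog _.
  by rewrite !card_prod -!mulnA.
split=> [/(unrefuted_gt0 arr env0) ne|[f [/sg_homP[s al] fL]]].
  (* No rule fires on a surviving tuple, which is path consistency. *)
  pose K u v a b := (u, v, a, b) \notin marked W (inst_vertices x) arr.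
  have K_fires u v z a b : K u v a b -> ~~ fires H G L u v z a b (marked W
    (inst_vertices x) arr).
    by apply: contra; apply: closed.
  have [||//|h [al hL]] := consistent_hom (G := G) (L := L) bip r_inj min_r
      special_r deg_uni balanced (K := K).
  - by move=> u v a b /(K_fires _ _ u); rewrite negb_or => /andP[].
  - move=> u v a b z /(K_fires _ _ z); rewrite negb_or => /andP[_].
    by rewrite negb_forall => /existsP[c]; rewrite negb_or; exists c.
  exists (fun u => (h u).1); split=> //; apply/sg_homP.
  by exists (fun u => (h u).2) => u v; rewrite -!surjective_pairing.
apply/(unrefuted_gt0 arr env0) => u; exists (f u, s u).
pose h v := (f v, s v).
(* The tuples that disagree with the solution form a closed set, so marking never leaves it and the
   solution survives. *)
pose C := [set t : inst_vertices x * inst_vertices x * (W * bool) * (W * bool) |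
  ~~ ((t.1.2 == h t.1.1.1) && (t.2 == h t.1.1.2))].
have clC : closed_all H G L C.
  move=> v v' z a b _; rewrite inE /=; apply: contraL => /andP[/eqP-> /eqP->].
  rewrite negb_or; apply/andP; split.
    rewrite /refuted !fL /= al orbF; apply/negP => /andP[/eqP->].
    by rewrite eqxx.
  by rewrite negb_forall; apply/existsP; exists (h z); rewrite !inE /= !eqxx.
have /subsetP/(_ (u, u, h u, h u)) : marked W (inst_vertices x) arr \subset C.
  by apply: least => //; apply/subsetP => t; rewrite inE.
by rewrite [_ \in C]inE /= !eqxx /=; case: (_ \in _) => // /(_ isT).
Qed.

Lemma polynomial_list_s_hom : list_s_hom_polynomial H.
Proof.
exists (decider 5 (propagate H) (unrefuted W)).
exists (decider_time (propagate H) (unrefuted W)) => x.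
have [env [env0 ->]] := decider_verdict (isT : 0 < 5) (scoped_propagate H)
  (scoped_unrefuted W) (card_le_size x) (@bits_ones _ x) (bits_zero x).
by eexists; [reflexivity | apply: decision_correct].
Qed.

End Decision.

(** * The ordering of a segmented path *)

Section IndexOrder.
Variables (n p q : nat) (L R : pred nat).

(* On indices along the path, [L] and [R] are the sources of the left-leaning and
   of the right-leaning segments, and the two-sided segment goes from [p] to
   [q + 1].  The one-sided cases are encoded by [p = q = 0] (everything leans
   right) and by [p = q > n] (everything leans left). *)
Definition jump (a b : nat) : bool :=
  [&& odd a != odd b, a + 3 <= b &
    [|| L b, R a | [&& a + 2 <= p, odd a == odd p & q + 3 <= b]]].
Definition near (a b : nat) : bool := (a == b.+1) || (b == a.+1).
Definition joined (a b : nat) : bool := [|| near a b, jump a b | jump b a].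

Hypothesis odd_pq : odd p = odd q.
Hypothesis pqP : [\/ p < q, p = 0 /\ q = 0 | n < p /\ p = q].
Hypothesis L_range : forall b, L b ->
  (b <= p) || [&& p + 3 <= b, b <= q + 1 & odd b != odd p].
Hypothesis L_mid : forall b, p + 3 <= b <= q + 1 -> odd b != odd p -> L b.
Hypothesis R_range : forall a, R a ->
  (q + 1 <= a) || [&& p <= a, a + 2 <= q & odd a == odd p].
Hypothesis R_mid : forall a, p <= a -> a + 2 <= q -> odd a == odd p -> R a.
Hypothesis L_sparse : forall a, L a -> ~~ L a.+1.
Hypothesis R_sparse : forall a, R a -> ~~ R a.+1.

(* The four groups of each class take values in consecutive ranges of length
   [n + 1]. *)
Definition key (a : nat) : nat :=
  if odd a == odd p then
    if (a <= p) && L a then n.+1 - a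
    else if (a + 2 <= q) || (a < p) then n.+1 + a
    else if R a then n.+1.*2 + a
    else n.+1.*2.*2 - a
  else
    if (q + 1 <= a) && R a then a
    else if (q + 1 <= a) || (p + 3 <= a) then n.+1.*2 - a
    else if L a then n.+1.*2 + n.+1 - a
    else n.+1.*2 + n.+1 + a.

Definition even_class (a : nat) : bool := odd a == odd p.

Lemma jumpE x y : even_class x -> ~~ even_class y ->
  (jump x y = (x + 3 <= y) && [|| L y, R x | (x + 2 <= p) && (q + 3 <= y)]) *
  (jump y x = (y + 3 <= x) && (L x || R y)).
Proof.
rewrite /jump /even_class => /eqP-> yp; rewrite eq_sym yp eqxx (negPf yp) /=.
by rewrite andbF orbF.
Qed.

Lemma L_even_false x : even_class x -> p < x -> L x = false.
Proof.
rewrite /even_class => xp px; apply/negP => /L_range;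
by rewrite xp leqNgt px !andbF. Qed.

Lemma R_odd_false y : ~~ even_class y -> y <= q -> R y = false.
Proof.
by rewrite /even_class => yp yq; apply/negP => /R_range; rewrite
  (negPf yp) !andbF orbF addn1 ltnNge yq.
Qed.

Lemma R_even_false x : even_class x -> (x < p) || (q <= x + 1) && (x <= q) ->
  R x = false.
Proof.
rewrite /even_class => xp x_out; apply/negP => /R_range; rewrite xp.
by case: pqP => *; lia.
Qed.

Lemma L_odd_false y : ~~ even_class y -> (q + 1 < y) || (p < y <= p + 1) ->
  L y = false.
Proof.
rewrite /even_class => yp y_out; apply/negP => /L_range; rewrite yp.
by case: pqP => *; lia.
Qed.

Lemma nearE x y : even_class x -> ~~ even_class y ->
  near x y = (x <= y.+1) && (y <= x.+1).
Proof. by rewrite /near /even_class => *; lia. Qed.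

Lemma far_apart x y : even_class x -> ~~ even_class y ->
  ((x + 3 <= y) = (x.+1 < y)) * ((y + 3 <= x) = (y.+1 < x)).
Proof. by rewrite /even_class => *; split; lia. Qed.

(** Right sources of the two-sided segment, its left sources and the cross pairs together fill a
    threshold relation, for which increasing [x] and decreasing [y] is a min ordering. *)
Lemma joined_mid x y : even_class x -> ~~ even_class y -> p < q ->
  x + 2 <= q -> p + 3 <= y -> joined x y = (x <= y.+1).
Proof.
move=> xp yp pq xq py; rewrite /joined !(jumpE xp yp) (nearE xp yp).
rewrite !(far_apart xp yp).
have [xy|xy] := leqP x y.+1; last first.
  by rewrite (L_even_false xp) ?(R_odd_false yp) ?andbF ?orbF => {xp yp}; lia.
have [px|px] := leqP p x.
  by rewrite (R_mid px xq xp) /= => {xp yp}; lia.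
have [yq|yq] := leqP y (q + 1).
  by rewrite L_mid ?py ?yq //= => {xp yp}; lia.
have -> : (x + 2 <= p) && (q + 3 <= y).
  by move: odd_pq xp yp; rewrite /even_class; lia.
by rewrite !orbT => {xp yp}; lia.
Qed.

(** In this zone a jump needs a right source at its left end: cross pairs start left of [p], and
    left sources of the odd class end at [q + 1], too close to [x]. *)
Lemma joined_right x y : even_class x -> ~~ even_class y ->
  q <= x -> q + 1 <= y ->
  joined x y = if R x then (x <= y.+1) || R y
    else (y <= x.+1) && ((x <= y.+1) || R y).
Proof.
move=> xp yp qx qy; rewrite /joined !(jumpE xp yp) (nearE xp yp).
rewrite !(far_apart xp yp).
have -> : (x + 2 <= p) = false by case: pqP => *; lia.
have [yx|yx] := leqP x y.+1; last first.
  have -> : x.+1 < y = false by lia.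
  have -> : y <= x.+1 by lia.
  rewrite (L_even_false xp); last by case: pqP => *; lia.
  by rewrite if_same.
have [xy|xy] := leqP y x.+1; first by rewrite if_same.
rewrite (L_odd_false yp) /=; last lia.
by rewrite !orbF; case: (R x).
Qed.

Lemma joined_left x y : even_class x -> ~~ even_class y ->
  x <= p -> y <= p + 1 -> p < q \/ n < p /\ p = q -> y <= q ->
  joined x y = if L x then (y <= x.+1) || L y
    else (x <= y.+1) && ((y <= x.+1) || L y).
Proof.
move=> xp yp px py pq yq; rewrite /joined !(jumpE xp yp) (nearE xp yp).
rewrite !(far_apart xp yp) (R_odd_false yp yq).
have [yx|yx] := leqP x y.+1; last first.
  have -> : x.+1 < y = false by lia.
  have -> : y <= x.+1 by lia.
  by rewrite /= orbF; case: (L x).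
have [xy|xy] := leqP y x.+1; first by rewrite if_same.
rewrite (R_even_false xp) /=; last lia.
rewrite (_ : q + 3 <= y = false) ?andbF ?orbF; last lia.
by rewrite if_same.
Qed.

(** Here [x] lies to the right of [y], and neither [L x] nor [R y] can hold, so only a path edge is
    left. *)
Lemma joined_corner x y : even_class x -> ~~ even_class y -> p < q ->
  (p + 2 <= x) && (y <= p + 1) || (q <= x) && (y < q) -> joined x y = (x == y.+1).
Proof.
move=> xp yp pq xy; rewrite /joined /near !(jumpE xp yp).
rewrite (L_even_false xp) ?(R_odd_false yp); lia.
Qed.

Lemma key_left_even x : even_class x -> x <= p -> p < q \/ x < p ->
  key x = if L x then n.+1 - x else n.+1 + x.
Proof.
move=> xp px pq; rewrite /key -/(even_class x) xp px /=; case: (L x) => //.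
by rewrite (_ : (x + 2 <= q) || (x < p)) //; lia.
Qed.

Lemma key_mid_even x : even_class x -> p < x -> x + 2 <= q ->
  key x = n.+1 + x.
Proof. by move=> xp px xq; rewrite /key -/(even_class x) xp xq leqNgt px. Qed.

Lemma key_right_even x : even_class x -> p < x \/ p < q -> p <= x -> q <= x ->
  key x = if R x then n.+1.*2 + x else n.+1.*2.*2 - x.
Proof.
move=> xp pqx px qx; rewrite /key -/(even_class x) xp.
by rewrite (_ : x <= p = false) 1?(_ : (x + 2 <= q) || (x < p) = false) //; lia.
Qed.

Lemma key_right_odd y : ~~ even_class y -> q + 1 <= y ->
  key y = if R y then y else n.+1.*2 - y.
Proof. by move=> yp qy; rewrite /key -/(even_class y) (negPf yp) qy. Qed.

Lemma key_mid_odd y : ~~ even_class y -> p + 3 <= y -> y <= q ->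
  key y = n.+1.*2 - y.
Proof.
by move=> yp py yq; rewrite /key -/(even_class y) (negPf yp) py orbT addn1 ltnNge yq.
Qed.

Lemma key_left_odd y : ~~ even_class y -> y <= p + 1 -> y <= q ->
  key y = if L y then n.+1.*2 + n.+1 - y else n.+1.*2 + n.+1 + y.
Proof.
move=> yp py yq; rewrite /key -/(even_class y) (negPf yp) addn1 ltnNge yq /=.
by rewrite (_ : p + 3 <= y = false) //; lia.
Qed.

(** The two conditionals describe the order by [key] in this zone, which is the same for both
    classes. Free of keys, the claim is settled by distinguishing which of the four vertices are
    sources. *)
Lemma right_order x x' y y' :
  even_class x -> even_class x' -> ~~ even_class y -> ~~ even_class y' ->
  q <= x -> q <= x' -> q + 1 <= y -> q + 1 <= y' ->
  (if R x then R x' ==> (x < x') else ~~ R x' && (x' < x)) ->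
  (if R y then R y' ==> (y < y') else ~~ R y' && (y' < y)) ->
  joined x y' -> joined x' y -> joined x y.
Proof.
move=> xp xp' yp yp' qx qx' qy qy' kx ky.
rewrite !joined_right //; move: kx ky {xp xp' yp yp' qx qx' qy qy'}.
by case: (R x); case: (R x'); case: (R y); case: (R y') => //=; lia.
Qed.

Lemma left_order x x' y y' :
  even_class x -> even_class x' -> ~~ even_class y -> ~~ even_class y' ->
  p < q \/ n < p /\ p = q ->
  x <= p -> x' <= p -> y <= p + 1 -> y' <= p + 1 -> y <= q -> y' <= q ->
  (if L x then L x' ==> (x' < x) else ~~ L x' && (x < x')) ->
  (if L y then L y' ==> (y' < y) else ~~ L y' && (y < y')) ->
  joined x y' -> joined x' y -> joined x y.
Proof.
move=> xp xp' yp yp' pq px px' py py' yq yq' kx ky.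
rewrite !joined_left //; move: kx ky {xp xp' yp yp' pq px px' py py' yq yq'}.
by case: (L x); case: (L x'); case: (L y); case: (L y') => //=; lia.
Qed.

Lemma region_even x : even_class x -> p < q ->
  [\/ x <= p, p < x /\ x + 2 <= q | q <= x].
Proof.
rewrite /even_class => xp pq.
have [px|px] := leqP x p; first by constructor 1.
have [qx|qx] := leqP q x; first by constructor 3.
by constructor 2; move: odd_pq; lia.
Qed.

Lemma region_odd y : ~~ even_class y -> p < q ->
  [\/ q + 1 <= y, p + 3 <= y /\ y + 1 <= q | y <= p + 1].
Proof.
rewrite /even_class => yp pq.
have [py|py] := leqP y (p + 1); first by constructor 3.
have [qy|qy] := leqP (q + 1) y; first by constructor 1.
by constructor 2; move: odd_pq; lia.
Qed.

(** This and the next lemmas say what a larger key implies in each zone: the even class runs through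
    the zones from left to right, the odd class from right to left. *)
Lemma above_mid_even x x' : even_class x -> even_class x' -> p < q ->
  x <= n -> x' <= n -> p < x -> x + 2 <= q -> key x < key x' -> x < x'.
Proof.
move=> xp xp' pq xn xn' px xq; rewrite (key_mid_even xp px xq).
case: (region_even xp' pq) => [px'|[px' xq']|qx'].
- rewrite key_left_even //; last by left.
  by case: (L x') => {xp xp'}; lia.
- by rewrite key_mid_even // => {xp xp'}; lia.
- by move=> _ {xp xp'}; lia.
Qed.

Lemma above_mid_odd y y' : ~~ even_class y -> ~~ even_class y' -> p < q ->
  y <= n -> y' <= n -> p + 3 <= y -> y + 1 <= q -> key y < key y' -> y' < y.
Proof.
move=> yp yp' pq yn yn' py yq; rewrite key_mid_odd //; last lia.
case: (region_odd yp' pq) => [qy'|[py' yq']|py'].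
- by rewrite key_right_odd //; case: (R y') => {yp yp'}; lia.
- by rewrite key_mid_odd //; last lia; move=> {yp yp'}; lia.
- by move=> _ {yp yp'}; lia.
Qed.

Lemma above_right_even x x' : even_class x -> even_class x' -> p < q ->
  x <= n -> x' <= n -> q <= x -> key x < key x' -> q <= x'.
Proof.
move=> xp xp' pq xn xn' qx; rewrite (key_right_even xp) //; [|by right|lia].
case: (region_even xp' pq) => [px'|[px' xq']|//].
- rewrite key_left_even //; last by left.
  by case: (L x'); case: (R x) => {xp xp'}; lia.
- by rewrite key_mid_even //; case: (R x) => {xp xp'}; lia.
Qed.

Lemma above_left_odd y y' : ~~ even_class y -> ~~ even_class y' -> p < q ->
  y <= n -> y' <= n -> y <= p + 1 -> key y < key y' -> y' <= p + 1.
Proof.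
move=> yp yp' pq yn yn' py; rewrite (key_left_odd yp) //; last lia.
case: (region_odd yp' pq) => [qy'|[py' yq']|//].
- by rewrite key_right_odd //; case: (R y'); case: (L y) => {yp yp'}; lia.
- by rewrite key_mid_odd //; last lia; case: (L y) => {yp yp'}; lia.
Qed.

Lemma above_right_even_R x x' : even_class x -> even_class x' ->
  p < q \/ p = 0 /\ q = 0 -> 0 < x <= n -> 0 < x' <= n -> q <= x -> q <= x' ->
  key x < key x' -> if R x then R x' ==> (x < x') else ~~ R x' && (x' < x).
Proof.
move=> xp xp' pq xn xn' qx qx'.
rewrite !key_right_even //; try by case: pq => [?|[? ?]]; [right | left; lia].
- by case: (R x); case: (R x') => //= {pq xp xp'}; lia.
- by move=> {xp xp'}; lia.
- by move=> {xp xp'}; lia.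
Qed.

Lemma above_right_odd_R y y' : ~~ even_class y -> ~~ even_class y' ->
  0 < y <= n -> 0 < y' <= n -> q + 1 <= y -> q + 1 <= y' ->
  key y < key y' -> if R y then R y' ==> (y < y') else ~~ R y' && (y' < y).
Proof.
move=> yp yp' yn yn' qy qy'; rewrite !key_right_odd //.
by case: (R y); case: (R y') => //= {yp yp'}; lia.
Qed.

Lemma above_left_even_L x x' : even_class x -> even_class x' ->
  p < q \/ n < p -> 0 < x <= n -> 0 < x' <= n -> x <= p -> x' <= p ->
  key x < key x' -> if L x then L x' ==> (x' < x) else ~~ L x' && (x < x').
Proof.
move=> xp xp' pq xn xn' px px'.
rewrite !key_left_even //; try by case: pq => [?|?]; [left | right; lia].
by case: (L x); case: (L x') => //= {pq xp xp'}; lia.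
Qed.

Lemma above_left_odd_L y y' : ~~ even_class y -> ~~ even_class y' ->
  0 < y <= n -> 0 < y' <= n -> y <= p + 1 -> y' <= p + 1 -> y <= q -> y' <= q ->
  key y < key y' -> if L y then L y' ==> (y' < y) else ~~ L y' && (y < y').
Proof.
move=> yp yp' yn yn' py py' yq yq'; rewrite !key_left_odd //.
by case: (L y); case: (L y') => //= {yp yp'}; lia.
Qed.

Section MinOrder.
Variables x x' y y' : nat.
Hypotheses (xp : even_class x) (xp' : even_class x').
Hypotheses (yp : ~~ even_class y) (yp' : ~~ even_class y').
Hypotheses (xn : 0 < x <= n) (xn' : 0 < x' <= n).
Hypotheses (yn : 0 < y <= n) (yn' : 0 < y' <= n).
Hypotheses (kx : key x < key x') (ky : key y < key y').
Hypotheses (jxy' : joined x y') (jx'y : joined x' y).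

Let x_le : x <= n. Proof. by case/andP: xn. Qed.
Let x_le' : x' <= n. Proof. by case/andP: xn'. Qed.
Let y_le : y <= n. Proof. by case/andP: yn. Qed.
Let y_le' : y' <= n. Proof. by case/andP: yn'. Qed.

(** The premises contradict each other: the larger key keeps [y'] to the left of [x], so that [x]
    and [y'] are joined by a path edge across the corner, and then no place is left for [x']. *)
Lemma corner_min : p < q ->
  (p + 2 <= x) && (y <= p + 1) || (q <= x) && (y < q) -> joined x y.
Proof.
move=> pq c; have pq2 : p + 2 <= q.
  by move: odd_pq pq; clear; lia.
have y_q : y < q by move: c pq2; clear; lia.
have p_x : p + 2 <= x by move: c pq2; clear; lia.
have y'_y : (y' <= p + 1) || (y' < y).
  have [py|py] := leqP y (p + 1).
    by rewrite (above_left_odd yp yp' pq y_le y_le' py ky).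
  have py3 : p + 3 <= y.
    by case: (region_odd yp pq) => [|[]|]; move: py y_q; clear; lia.
  apply/orP; right; apply: (above_mid_odd yp yp' pq y_le y_le' py3 _ ky).
  by move: y_q; clear; lia.
have xE : x = y'.+1.
  apply/eqP; rewrite -(joined_corner xp yp' pq) //.
  by move: c y'_y p_x pq2; clear; lia.
have [qx|qx] := leqP q x.
  have qx' := above_right_even xp xp' pq x_le x_le' qx kx.
  have Rx : R x = false.
    apply: R_even_false => //; apply/orP; right.
    by move: xE y'_y y_q qx p_x pq2; clear; lia.
  have := above_right_even_R xp xp' (or_introl pq) xn xn' qx qx' kx.
  rewrite Rx => /andP[_]; move: xE y'_y y_q qx p_x pq2 qx'; clear; lia.
have xx' : x < x'.
  apply: (above_mid_even xp xp' pq x_le x_le' _ _ kx).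
    by move: p_x; clear; lia.
  by case: (region_even xp pq) => [|[]|]; move: p_x qx; clear; lia.
have [py|py] := leqP y (p + 1); last first.
  by move: c py qx; clear; lia.
have : x' = y.+1.
  apply/eqP; rewrite -(joined_corner xp' yp pq) //.
  by move: xx' p_x py; clear; lia.
rewrite joined_corner //.
move: xE y'_y p_x py xx'; clear; lia.
Qed.

(** Outside the corners [x] and [y] share a zone, whose own order applies. If [x'] or [y'] lies
    beyond the zone, its edge crosses a corner and is a path edge, which leads to a contradiction.
    The one-sided cases have a single zone. *)
Lemma joined_min : joined x y.
Proof.
case: pqP => [pq|[p0 q0]|[np pq]].
- have [c|/negP c] := boolP ((p + 2 <= x) && (y <= p + 1) || (q <= x) && (y < q)).
    exact: corner_min.
  have [qx|xq] := leqP q x.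
    have qy : q + 1 <= y.
      case: (region_odd yp pq) => [//|[]|]; move: c qx pq odd_pq; clear; lia.
    have qx' := above_right_even xp xp' pq x_le x_le' qx kx.
    have ordx := above_right_even_R xp xp' (or_introl pq) xn xn' qx qx' kx.
    have [qy'|yq'] := leqP (q + 1) y'.
      apply: (right_order xp xp' yp yp') => //.
      exact: (above_right_odd_R yp yp' yn yn' qy qy' ky).
    have pq2 : p + 2 <= q by move: odd_pq pq; clear; lia.
    have yq2 : y' < q.
      by case: (region_odd yp' pq) => [|[]|]; move: yq' pq2; clear; lia.
    have xE : x = y'.+1.
      by apply/eqP; rewrite -(joined_corner xp yp' pq) // qx yq2 orbT.
    have Rx : R x = false.
      by apply: R_even_false => //; move: xE qx yq2; clear; lia.
    by move: ordx; rewrite Rx; move: xE qx yq2 qx'; clear; lia.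
  have [py|py] := leqP y (p + 1); last first.
    have py3 : p + 3 <= y.
      by case: (region_odd yp pq) => [|[]|]; move: pq py odd_pq; clear; lia.
    have xq2 : x + 2 <= q.
      by case: (region_even xp pq) => [|[]|]; move: pq xq odd_pq; clear; lia.
    rewrite joined_mid // leqNgt; apply/negP => yx.
    have yq : y + 1 <= q by move: yx xq2; clear; lia.
    have yy' := above_mid_odd yp yp' pq y_le y_le' py3 yq ky.
    case: (region_odd yp' pq) => [|[py' _]|py'].
    + by move: yy' yq; clear; lia.
    + by move: jxy'; rewrite joined_mid //; move: yx yy'; clear; lia.
    + have : x = y'.+1.
        apply/eqP; rewrite -(joined_corner xp yp' pq) // py' andbT.
        by apply/orP; left; move: yx py3; clear; lia.
      by move: yx yy'; clear; lia.
  have px : x <= p.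
    by case: (region_even xp pq) => [//|[]|]; move: c py xq xp; rewrite /even_class; clear; lia.
  have py' := above_left_odd yp yp' pq y_le y_le' py ky.
  have pq2 : p + 2 <= q by move: odd_pq pq; clear; lia.
  have [yq yq'] : y <= q /\ y' <= q by move: py py' pq2; clear; lia.
  have ordy := above_left_odd_L yp yp' yn yn' py py' yq yq' ky.
  have [px'|px'] := leqP x' p.
    apply: (left_order xp xp' yp yp' _ px px' py py') => //; first by left.
    exact: (above_left_even_L xp xp' (or_introl pq) xn xn' px px' kx).
  have px2 : p + 2 <= x'.
    by case: (region_even xp' pq) => [|[]|]; move: px' pq2 xp'; rewrite /even_class; clear; lia.
  have xE' : x' = y.+1.
    by apply/eqP; rewrite -(joined_corner xp' yp pq) // px2 py.
  have Ly : L y = false by apply: L_odd_false => //; move: xE' px2 py; clear; lia.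
  by move: ordy; rewrite Ly; move: xE' px2 py'; clear; lia.
- have [qx qx'] : q <= x /\ q <= x' by rewrite q0.
  have [qy qy'] : q + 1 <= y /\ q + 1 <= y'.
    by rewrite q0; case/andP: yn; case/andP: yn'.
  have pq : p < q \/ p = 0 /\ q = 0 by right.
  apply: (right_order xp xp' yp yp') => //.
    exact: (above_right_even_R xp xp' pq xn xn' qx qx' kx).
  exact: (above_right_odd_R yp yp' yn yn' qy qy' ky).
have pq' : p < q \/ n < p /\ p = q by right.
have [px px'] : x <= p /\ x' <= p.
  by move: x_le x_le' np; clear; lia.
have [py py'] : y <= p + 1 /\ y' <= p + 1.
  by move: y_le y_le' np; clear; lia.
have [qy qy'] : y <= q /\ y' <= q.
  by move: y_le y_le' np pq; clear; lia.
apply: (left_order xp xp' yp yp' pq') => //.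
  exact: (above_left_even_L xp xp' (or_intror np) xn xn' px px' kx).
exact: (above_left_odd_L yp yp' yn yn' py py' qy qy' ky).
Qed.

End MinOrder.

Lemma key_inj a b : even_class a = even_class b -> 0 < a <= n -> 0 < b <= n ->
  key a = key b -> a = b.
Proof.
rewrite /key -!/(even_class _) => ->.
case: even_class; do !case: ifP => _; clear; lia.
Qed.

(** With [key_odd_nonR] this separates [u] from [w] in [special_even]. For a right source it rests
    on [u <= n.+1.*2 - u], which follows from [u <= n]. *)
Lemma key_odd_high u : ~~ even_class u -> u <= n -> p + 3 <= u ->
  key u <= n.+1.*2 - u.
Proof.
move=> up un pu; have [qu|qu] := leqP (q + 1) u.
  by rewrite key_right_odd //; case: (R u); move: un; clear; lia.
by rewrite key_mid_odd //; move: qu; clear; lia.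
Qed.

Lemma key_odd_nonR w : ~~ even_class w -> R w = false -> w <= n ->
  n.+1.*2 - w <= key w.
Proof.
move=> wp Rw wn; rewrite /key -/(even_class w) (negPf wp) Rw andbF.
by do !case: ifP => _; move: wn; clear; lia.
Qed.

Lemma key_even_low u : even_class u -> (u + 2 <= q) || (u < p) ->
  key u <= n.+1 + u.
Proof.
by move=> up uq; rewrite /key -/(even_class u) up uq; case: ifP => _; clear; lia.
Qed.

Lemma key_even_nonL w : even_class w -> L w = false -> w <= n ->
  n.+1 + w <= key w.
Proof.
move=> wp Lw wn; rewrite /key -/(even_class w) wp Lw andbF.
by do !case: ifP => _; move: wn; clear; lia.
Qed.

(** Path neighbours of a source thus belong to the non-sources, which are listed after the
    sources. *)
Lemma near_sparse (S : pred nat) x w : (forall a, S a -> ~~ S a.+1) ->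
  near x w -> S x -> S w = false.
Proof.
move=> sparse /orP[/eqP-> Sw|/eqP-> /sparse/negPf//].
by apply/negP => /sparse; rewrite Sw.
Qed.

Lemma nearP x w : near x w -> w <= x.+1 /\ x <= w.+1.
Proof. by case/orP => /eqP->; rewrite ?leqnn !leqW. Qed.

Lemma p_le_q : 0 < n -> p <= q.
Proof. by case: pqP => [/ltnW|[-> ->]|[_ ->]]. Qed.

(** The cases follow the reason for the jump. If [x] is a source, [w] is not, and the farther vertex
    [u] comes first because non-sources come back. If [u] is a source outside the two-sided segment,
    it is nearer to that segment than [w], and sources move away. Otherwise [high_case] compares
    indices. *)
Lemma special_even x u w : even_class x -> ~~ even_class u -> ~~ even_class w ->
  0 < x <= n -> 0 < u <= n -> 0 < w <= n ->
  jump x u || jump u x -> near x w -> key u < key w.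
Proof.
move=> xp up wp xn un wn; rewrite !(jumpE xp up) => jxu xw.
have [wx xw'] := nearP xw.
have [_ u_le] := andP un; have [_ w_le] := andP wn.
have [_ x_le] := andP xn.
have pq : p <= q by apply: p_le_q; move: xn; clear; lia.
have high_case : p + 3 <= u -> x + 3 <= u -> R w = false -> key u < key w.
  move=> pu xu Rw; apply: leq_ltn_trans (key_odd_high up u_le pu) _.
  apply: leq_trans (key_odd_nonR wp Rw w_le).
  by move: xu wx u_le; clear; lia.
case/orP: jxu => [/andP[xu /or3P[Lu|Rx|/andP[xp2 uq]]]|/andP[ux /orP[Lx|Ru]]].
- have [pu|pu] := leqP (p + 3) u.
    apply: high_case => //; apply: R_odd_false => //.
    by move: (L_range Lu) xu wx pq; clear; lia.
  have up' : u <= p by move: (L_range Lu) pu; clear; lia.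
  rewrite !key_left_odd //; try by move: up' pq xu wx; clear; lia.
  by rewrite Lu; case: (L w); move: xu wx u_le; clear; lia.
- apply: high_case => //; last exact: near_sparse R_sparse xw Rx.
  by move: (R_range Rx) pq xu; clear; lia.
- apply: high_case => //; first by move: pq uq; clear; lia.
  by apply: R_odd_false => //; move: wx xp2 pq; clear; lia.
- have px : x <= p.
    by rewrite leqNgt; apply/negP => /(L_even_false xp); rewrite Lx.
  have Lw := near_sparse L_sparse xw Lx.
  have wq : w <= q.
    case: pqP => [pq'|[p0 _]|[np _]].
    + by move: wx px pq'; clear; lia.
    + by move: px xn p0; clear; lia.
    + by move: np w_le pq; clear; lia.
  rewrite !key_left_odd //; try by move: px pq ux wx; clear; lia.
  by rewrite Lw; case: (L u); move: ux xw' u_le w_le; clear; lia.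
have qu : q + 1 <= u.
  by rewrite addn1 ltnNge; apply/negP => /(R_odd_false up); rewrite Ru.
rewrite !key_right_odd ?Ru //; last by move: qu ux xw'; clear; lia.
by case: (R w); move: ux xw' u_le w_le; clear; lia.
Qed.

Lemma special_odd x u w : ~~ even_class x -> even_class u -> even_class w ->
  0 < x <= n -> 0 < u <= n -> 0 < w <= n ->
  jump x u || jump u x -> near x w -> key u < key w.
Proof.
move=> xp up wp xn un wn; rewrite !(jumpE up xp) => jxu xw.
have [wx xw'] := nearP xw.
have [u0 u_le] := andP un; have [w0 w_le] := andP wn.
have [_ x_le] := andP xn.
have pq : p <= q by apply: p_le_q; move: xn; clear; lia.
have low_case : (u + 2 <= q) || (u < p) -> u + 3 <= x -> L w = false ->
    key u < key w.
  move=> pu ux Lw; apply: leq_ltn_trans (key_even_low up pu) _.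
  apply: leq_trans (key_even_nonL wp Lw w_le).
  by move: ux xw'; clear; lia.
case/orP: jxu => [/andP[xu /orP[Lu|Rx]]|/andP[ux /or3P[Lx|Ru|/andP[up2 xq]]]].
- have pu : u <= p.
    by rewrite leqNgt; apply/negP => /(L_even_false up); rewrite Lu.
  have pqn : p < q \/ n < p.
    case: pqP => [pq'|[p0 _]|[np _]]; [by left | | by right].
    by move: pu p0 u0; clear; lia.
  have pu' : p < q \/ u < p by case: pqn; [left | right; apply: leq_ltn_trans u_le _].
  have pw' : p < q \/ w < p by case: pqn; [left | right; apply: leq_ltn_trans w_le _].
  rewrite (key_left_even up pu pu') (key_left_even wp _ pw').
    by rewrite Lu; case: (L w); move: xu wx u0 u_le w0; clear; lia.
  by move: pu xu wx; clear; lia.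
- have qx : q + 1 <= x.
    by rewrite addn1 ltnNge; apply/negP => /(R_odd_false xp); rewrite Rx.
  have Rw := near_sparse R_sparse xw Rx.
  have pw : p < w \/ p < q.
    case: pqP => [pq'|[p0 _]|[np _]]; [by right | by left; rewrite p0 | left].
    by move: np qx pq x_le; clear; lia.
  rewrite (key_right_even up); try by left; move: qx pq xu; clear; lia.
  rewrite (key_right_even wp pw).
  + by rewrite Rw; case: (R u); move: xu wx u_le w_le; clear; lia.
  + by move: qx pq xw'; clear; lia.
  + by move: qx xw'; clear; lia.
  + by move: qx pq xu; clear; lia.
  + by move: qx xu; clear; lia.
- apply: low_case => //; last exact: near_sparse L_sparse xw Lx.
  by move: (L_range Lx) ux pq; clear; lia.
- have := R_range Ru; have [qu _|qu] := leqP (q + 1) u; last first.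
    move=> /= /and3P[pu uq _].
    apply: low_case; rewrite ?uq //; apply: L_even_false => //.
    by move: pu ux xw'; clear; lia.
  have pu : p < u \/ p < q by left; move: qu pq; clear; lia.
  have pw : p < w \/ p < q by left; move: qu pq ux xw'; clear; lia.
  rewrite (key_right_even up pu) ?(key_right_even wp pw);
    try by move: qu pq ux xw'; clear; lia.
  by rewrite Ru; case: (R w); move: ux xw' u_le w_le; clear; lia.
- apply: low_case => //; first by rewrite orbC (leq_trans _ up2) // addn2 ltnW.
  by apply: L_even_false => //; move: xw' xq pq; clear; lia.
Qed.

End IndexOrder.

(** The ranges of [i + e] and, in [left_source], of [i + 2 * j + 1 - e] in the definition of
    leaning, with additive bounds instead of truncated differences. *)
Definition right_source (i j a : nat) : bool :=
  [&& i <= a, a + 2 <= i + 2 * j & odd a == odd i].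
Definition left_source (i j b : nat) : bool :=
  [&& i + 3 <= b, b <= i + 2 * j + 1 & odd b != odd i].

(** * Segmented graphs as instances of the index model *)

Section Segments.
Variables (V : finType) (H : signed_graph V) (v : nat -> V).
Local Notation n := #|V|.

Lemma right_pairP i j a b : 0 < j -> right_pair V i j a b <->
  [&& right_source i j a, a + 3 <= b <= n & odd a != odd b].
Proof.
rewrite /right_source => j0; split.
  move=> [e [o [[eo e_le oo o3] [le_n -> ->]]]].
  by move: eo e_le oo o3 le_n j0; clear; lia.
move=> h; exists (a - i), (b - a).
by move: h j0; clear => h j0; split; split; lia.
Qed.

Lemma left_pairP i j a b : 0 < j -> left_pair i j a b <->
  [&& left_source i j a, 0 < b, b + 3 <= a & odd a != odd b].
Proof.
rewrite /left_source => j0; split.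
  move=> [e [o [[eo e_le oo o3] [le_n -> ->]]]].
  by move: eo e_le oo o3 le_n j0; clear; lia.
move=> h; exists (i + 2 * j + 1 - a), (a - b).
by move: h j0; clear => h j0; split; split; lia.
Qed.

Lemma cross_pairP i j a b : cross_pair V i j a b <->
  [&& 0 < a, a + 2 <= i, odd a == odd i, i + 2 * j + 3 <= b <= n
    & odd a != odd b].
Proof.
split.
  move=> [e [o [[eo e2 oo o3] [ie le_n -> ->]]]].
  by move: eo e2 oo o3 ie le_n; clear; lia.
move=> h; exists (i - a), (b - (i + 2 * j)).
by move: h; clear => h; split; split; lia.
Qed.

Hypothesis irr : irreflexive_sg H.
Hypothesis path_v : unicoloured_spanning_path H v.
Hypothesis disj : segments_edge_disjoint H v.

Lemma segment_bounds i j : segment H v i j ->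
  [/\ 0 < i, 0 < j & i + 2 * j + 1 <= n].
Proof. by case=> -[]. Qed.

Lemma segment_unique i j j' : segment H v i j -> segment H v i j' -> j = j'.
Proof.
move=> [pre max] [pre' max']; have [le|lt] := leqP j j'.
  have le' : i + 2 * j + 1 <= i + 2 * j' + 1 by move: le; clear; lia.
  by have [_ ->] := max _ _ pre' (leqnn _) le'.
have le' : i + 2 * j' + 1 <= i + 2 * j + 1 by move: lt; clear; lia.
by have [_ ->] := max' _ _ pre (leqnn _) le'.
Qed.

(** Sources of one segment share a parity, and edge-disjointness leaves a gap between the sources of
    two segments. *)
Lemma source_sparse i j i' j' a : segment H v i j -> segment H v i' j' ->
  (right_source i j a -> ~~ right_source i' j' a.+1) /\
  (left_source i j a -> ~~ left_source i' j' a.+1).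
Proof.
move=> s s'; rewrite /right_source /left_source; case: (ltngtP i i') => ii'.
- by have := disj s s' ii'; clear => le; split; lia.
- by have := disj s' s ii'; clear => le; split; lia.
rewrite -ii' in s' *; rewrite -(segment_unique s s'); clear; split; lia.
Qed.

Lemma path_unicoloured i : 0 < i < n -> unicoloured H (v i) (v i.+1).
Proof. by case: path_v => _ _ P i_n; apply/P; exists i => //; left. Qed.

Section Relation.
Variable E : nat -> nat -> Prop.
Hypothesis bi_E : all_bicoloured H v E.
Hypothesis only_E : no_edges_besides H v E.

Lemma bicolouredP a b : 0 < a -> a < b -> b <= n ->
  bicoloured H (v a) (v b) <-> E a b \/ E b a.
Proof.
move=> a0 ab bn; split; last first.
  by case=> [/bi_E//|/bi_E]; rewrite bicoloured_sym.
move=> bi; have an : a <= n by apply: leq_trans bn; apply: ltnW.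
have b0 : 0 < b by apply: leq_ltn_trans ab.
have := only_E (a := a) (b := b).
rewrite a0 an b0 bn => /(_ isT isT (bicoloured_edge bi)).
case=> [aE|bE|?|?]; [| | by left | by right].
  by move: ab; rewrite aE => /ltnW; rewrite ltnn.
have := path_unicoloured (i := a); rewrite a0 -bE bn => /(_ isT).
by rewrite /unicoloured bi andbF.
Qed.

Lemma bicoloured_jump p q (L R : pred nat) :
  (forall a b, 0 < a -> a < b -> b <= n ->
    E a b \/ E b a <-> jump p q L R a b) ->
  forall a b, 0 < a <= n -> 0 < b <= n ->
    bicoloured H (v a) (v b) = jump p q L R a b || jump p q L R b a.
Proof.
have no_jump a b : b <= a -> jump p q L R a b = false.
  by move=> ba; rewrite /jump (_ : a + 3 <= b = false) ?andbF //; lia.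
move=> EJ; have main a b : 0 < a -> a < b -> b <= n ->
    bicoloured H (v a) (v b) = jump p q L R a b.
  move=> a0 ab bn; apply/idP/idP => [/(bicolouredP a0 ab bn)|J].
    by move/(EJ a b a0 ab bn).
  by apply/(bicolouredP a0 ab bn)/(EJ a b a0 ab bn).
move=> a b /andP[a0 an] /andP[b0 bn]; case: (ltngtP a b) => [ab|ba|<-].
- by rewrite main // (no_jump b a) ?orbF // ltnW.
- by rewrite bicoloured_sym main // (no_jump a b) // ltnW.
rewrite no_jump // orbF; apply/negP => /bicoloured_edge.
by apply/negP/irr.
Qed.

End Relation.

(** The hypotheses of the ordering on indices, together with the identification of bicoloured edges
    with jumps. *)
Definition index_model p q (L R : pred nat) : Prop :=
  (odd p = odd q /\ [\/ p < q, p = 0 /\ q = 0 | n < p /\ p = q]) /\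
  [/\ forall b, L b ->
        (b <= p) || [&& p + 3 <= b, b <= q + 1 & odd b != odd p],
      forall b, p + 3 <= b <= q + 1 -> odd b != odd p -> L b,
      forall a, R a ->
        (q + 1 <= a) || [&& p <= a, a + 2 <= q & odd a == odd p]
    & forall a, p <= a -> a + 2 <= q -> odd a == odd p -> R a] /\
  [/\ forall a, L a -> ~~ L a.+1, forall a, R a -> ~~ R a.+1
    & forall a b, 0 < a <= n -> 0 < b <= n ->
        bicoloured H (v a) (v b) = jump p q L R a b || jump p q L R b a].

Definition sources (src : nat -> nat -> nat -> bool) (P : nat -> Prop) : pred nat :=
  fun a => asbool (exists i j, [/\ segment H v i j, P i & src i j a]).

Lemma sources_sparse P :
  (forall a, sources right_source P a -> ~~ sources right_source P a.+1) /\
  (forall a, sources left_source P a -> ~~ sources left_source P a.+1).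
Proof.
split=> a /asboolP[i [j [s _ ra]]]; apply/negP => /asboolP[i' [j' [s' _]]];
  apply/negP; move: ra; first exact: (source_sparse a s s').1.
exact: (source_sparse a s s').2.
Qed.

Lemma right_model : right_segmented H v ->
  index_model 0 0 pred0 (sources right_source (fun=> True)).
Proof.
move=> [lean only]; split; first by split=> //; constructor 2.
split.
  split=> // [b|a /asboolP[i [j [/segment_bounds[i0 _ _] _ /andP[ia _]]]]|a _].
    by clear; lia.
    by move: i0 ia; clear; lia.
  by clear; lia.
have [sp _] := sources_sparse (fun=> True); split=> //.
apply: (bicoloured_jump _ only).
  by move=> a b [i [j [s]]]; apply: lean.
move=> a b a0 ab bn; split.
  case=> -[i [j [s]]]; have [_ j0 _] := segment_bounds s.
    move/(right_pairP _ _ _ j0) => /and3P[ra /andP[ab3 _] odd_ab].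
    rewrite /jump odd_ab ab3 /=; apply/orP; left.
    by apply/asboolP; exists i, j.
  move/(right_pairP _ _ _ j0) => /and3P[_ /andP[ba _] _].
  by move: ab ba; clear; lia.
rewrite /jump => /and3P[odd_ab ab3 /or3P[//|/asboolP[i [j [s _ ra]]]|]].
  left; exists i, j; split=> //; have [_ j0 _] := segment_bounds s.
  by apply/right_pairP => //; rewrite ra ab3 bn.
by clear; lia.
Qed.

Lemma left_model : left_segmented H v ->
  index_model n.+1 n.+1 (sources left_source (fun=> True)) pred0.
Proof.
move=> [lean only]; split; first by split=> //; constructor 3.
split.
  split=> // [b /asboolP[i [j [/segment_bounds[_ _ le_n] _ /and3P[_ le _]]]]|b|a].
  - by move: le_n le; clear; lia.
  - by clear; lia.
  - by clear; lia.
have [_ sp] := sources_sparse (fun=> True); split=> //.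
apply: (bicoloured_jump _ only).
  by move=> a b [i [j [s]]]; apply: lean.
move=> a b a0 ab bn; split.
  case=> -[i [j [s]]]; have [_ j0 _] := segment_bounds s.
    move/(left_pairP _ _ _ j0) => /and4P[_ _ ba _].
    by move: ab ba; clear; lia.
  move/(left_pairP _ _ _ j0) => /and4P[lb _ ab3 odd_ab].
  rewrite /jump eq_sym odd_ab ab3 /=; apply/orP; left.
  by apply/asboolP; exists i, j.
rewrite /jump => /and3P[odd_ab ab3 /or3P[/asboolP[i [j [s _ lb]]]|//|]].
  right; exists i, j; split=> //; have [_ j0 _] := segment_bounds s.
  by apply/left_pairP => //; rewrite lb a0 ab3 eq_sym.
by move: bn; clear; lia.
Qed.

(** The two-sided segment contributes sources of both kinds, hence the weak inequalities;
    [i + 2 * j] is its last index but one. *)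
Lemma left_right_model i j :
  two_sided_segment H v i j ->
  (forall i' j', segment H v i' j' -> i' < i -> left_leaning H v i' j') ->
  (forall i' j', segment H v i' j' -> i < i' -> right_leaning H v i' j') ->
  all_bicoloured H v (cross_pair V i j) ->
  no_edges_besides H v (fun a b =>
    [\/ exists i' j', [/\ segment H v i' j', i' <= i & left_pair i' j' a b],
        exists i' j', [/\ segment H v i' j', i <= i' & right_pair V i' j' a b]
      | cross_pair V i j a b]) ->
  index_model i (i + 2 * j) (sources left_source (fun i' => i' <= i))
    (sources right_source (fun i' => i <= i')).
Proof.
move=> [s leanl leanr] lean_before lean_after cross only.
have [i0 j0 ijn] := segment_bounds s.
split; first by split; [clear; lia | constructor 1; move: j0; clear; lia].
split.
  split.
  - move=> b /asboolP[i' [j' [s' le_i]]]; rewrite leq_eqVlt in le_i.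
    case/orP: le_i => [/eqP iE|lt_i] lb.
      rewrite iE in s' lb; rewrite (segment_unique s s').
      by move: lb; rewrite /left_source; clear; lia.
    by move: (disj s' s lt_i) lb; rewrite /left_source; clear; lia.
  - move=> b b_mid odd_b; apply/asboolP; exists i, j; split=> //.
    by move: b_mid odd_b; rewrite /left_source; clear; lia.
  - move=> a /asboolP[i' [j' [s' le_i]]]; rewrite leq_eqVlt in le_i.
    case/orP: le_i => [/eqP iE|lt_i] ra.
      rewrite -iE in s' ra; rewrite (segment_unique s s').
      by move: ra; rewrite /right_source; clear; lia.
    by move: (disj s s' lt_i) ra; rewrite /right_source; clear; lia.
  move=> a ia aij odd_a; apply/asboolP; exists i, j; split=> //.
  by rewrite /right_source ia aij odd_a.
have [_ spl] := sources_sparse (fun i' => i' <= i).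
have [spr _] := sources_sparse (fun i' => i <= i'); split=> //.
apply: (bicoloured_jump _ only).
  move=> a b [[i' [j' [s' le_i]]]|[i' [j' [s' le_i]]]|]; last exact: cross.
    move: le_i; rewrite leq_eqVlt => /orP[/eqP iE|lt_i].
      by rewrite iE in s' *; rewrite -(segment_unique s s'); apply: leanl.
    exact: lean_before s' lt_i _ _.
  move: le_i; rewrite leq_eqVlt => /orP[/eqP iE|lt_i].
    by rewrite -iE in s' *; rewrite -(segment_unique s s'); apply: leanr.
  exact: lean_after s' lt_i _ _.
move=> a b a0 ab bn; split.
  case=> -[[i' [j' [s' le_i]]]|[i' [j' [s' le_i]]]|];
    try have [_ j0' _] := segment_bounds s'.
  - move/(left_pairP _ _ _ j0') => /and4P[_ _ ba _].
    by move: ab ba; clear; lia.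
  - move/(right_pairP _ _ _ j0') => /and3P[ra /andP[ab3 _] odd_ab].
    rewrite /jump odd_ab ab3 /=; apply/or3P/Or32/asboolP.
    by exists i', j'.
  - move/cross_pairP => /and5P[_ ai odd_a /andP[b_ij _] odd_ab].
    rewrite /jump odd_ab ai odd_a b_ij !orbT andbT /=.
    by move: ai b_ij; clear; lia.
  - move/(left_pairP _ _ _ j0') => /and4P[lb _ ab3 odd_ab].
    rewrite /jump eq_sym odd_ab ab3 /=; apply/or3P/Or31/asboolP.
    by exists i', j'.
  - move/(right_pairP _ _ _ j0') => /and3P[_ /andP[ba _] _].
    by move: ab ba; clear; lia.
  - move/cross_pairP => /and5P[_ bi _ /andP[ai _] _].
    by move: ab ai bi; clear; lia.
rewrite /jump => /and3P[odd_ab ab3].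
case/or3P => [/asboolP[i' [j' [s' le_i lb]]]|/asboolP[i' [j' [s' le_i ra]]]|].
- right; constructor 1; exists i', j'; split=> //.
  have [_ j0' _] := segment_bounds s'.
  by apply/left_pairP => //; rewrite lb a0 ab3 eq_sym.
- left; constructor 2; exists i', j'; split=> //.
  have [_ j0' _] := segment_bounds s'.
  by apply/right_pairP => //; rewrite ra ab3 bn.
move=> /and3P[ai odd_a b_ij]; left; constructor 3; apply/cross_pairP.
by rewrite a0 ai odd_a b_ij bn.
Qed.

End Segments.

(** * From indices back to vertices *)

Section PathOrder.
Variables (V : finType) (H : signed_graph V) (v : nat -> V).
Local Notation n := #|V|.
Hypothesis path_v : unicoloured_spanning_path H v.

Let indexP x : exists i, (0 < i <= n) && (x == v i).
Proof.
by case: path_v => _ sp _; have [i i_n ->] := sp x; exists i; rewrite i_n eqxx.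
Qed.

Definition index_of x : nat := xchoose (indexP x).

Lemma index_of_range x : 0 < index_of x <= n.
Proof. by have /andP[] := xchooseP (indexP x). Qed.

Lemma index_ofK x : v (index_of x) = x.
Proof. by have /andP[_ /eqP] := xchooseP (indexP x). Qed.

Lemma index_of_v i : 0 < i <= n -> index_of (v i) = i.
Proof.
by move=> i_n; case: path_v => inj _ _; apply: inj; rewrite ?index_of_range ?index_ofK.
Qed.

Lemma unicoloured_near x y : unicoloured H x y -> near (index_of x) (index_of y).
Proof.
case: path_v => _ _ P /P[i /andP[i0 i_n]].
have i_r : 0 < i <= n by rewrite i0 ltnW.
by case=> -[-> ->]; rewrite /near !index_of_v // eqxx ?orbT.
Qed.

Lemma unicoloured_degree x a b c : unicoloured H x a -> unicoloured H x b ->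
  unicoloured H x c -> [|| a == b, b == c | a == c].
Proof.
have idx_eq y z : (y == z) = (index_of y == index_of z).
  by apply/eqP/eqP => [->//|E]; rewrite -(index_ofK y) E index_ofK.
move=> /unicoloured_near + /unicoloured_near + /unicoloured_near.
rewrite !idx_eq /near; clear; lia.
Qed.

(* The vertices to switch for the path to become blue. *)
Fixpoint path_sign (i : nat) : bool :=
  if i is j.+1 then path_sign j (+) ~~ blue H (v j) (v j.+1) else false.

Lemma path_balanced x y : unicoloured H x y ->
  blue H x y = (path_sign (index_of x) == path_sign (index_of y)).
Proof.
case: path_v => _ _ P /P[i /andP[i0 i_n]].
have i_r : 0 < i <= n by rewrite i0 ltnW.
case=> -[-> ->]; rewrite !index_of_v //=; last rewrite [LHS]blue_sym;
  by case: (path_sign i); case: (blue H (v i) _).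
Qed.

Variables (p q : nat) (L R : pred nat).
Hypothesis model : index_model H v p q L R.

Let side x := even_class p (index_of x).
Let rank x := key n p q L R (index_of x).

Lemma bicolouredE x y : bicoloured H x y =
  jump p q L R (index_of x) (index_of y) || jump p q L R (index_of y) (index_of x).
Proof.
case: model => _ [_ [_ _ E]].
by rewrite -E ?index_of_range // !index_ofK.
Qed.

Lemma edge_joined x y : edge H x y = joined p q L R (index_of x) (index_of y).
Proof.
have near_edge i k : 0 < i <= n -> 0 < k <= n -> near i k -> edge H (v i) (v k).
  case: path_v => _ _ P i_n k_n nr; apply/unicoloured_edge/P.
  move: nr; rewrite /near => /orP[/eqP E|/eqP E]; rewrite {}E in i_n k_n *.
    by exists k; [move: i_n k_n; clear; lia | right].
  by exists i; [move: i_n k_n; clear; lia | left].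
rewrite /joined -bicolouredE; apply/idP/orP.
  by case/edge_uni_or_bi => [/unicoloured_near|]; [left | right].
case=> [nr|/bicoloured_edge//].
by have := near_edge _ _ (index_of_range x) (index_of_range y) nr; rewrite !index_ofK.
Qed.

Lemma side_bip x y : edge H x y -> side x != side y.
Proof.
rewrite edge_joined /joined /side /even_class /near /jump.
move: (index_of x) (index_of y) => i k.
case/or3P => [/orP[]/eqP->|/andP[+ _]|/andP[+ _]] /=.
- by case: (odd k); case: (odd p).
- by case: (odd i); case: (odd p).
- by case: (odd k); case: (odd i); case: (odd p).
- by case: (odd k); case: (odd i); case: (odd p).
Qed.

Lemma rank_inj x y : side x = side y -> rank x = rank y -> x = y.
Proof.
move=> sxy rxy; rewrite -(index_ofK x) -(index_ofK y); congr v.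
by apply: (key_inj sxy) rxy; apply: index_of_range.
Qed.

Lemma rank_min x x' y y' : side x = side x' ->
  rank x < rank x' -> rank y < rank y' -> edge H x y' -> edge H x' y ->
  edge H x y.
Proof.
move=> sx rx ry xy' x'y; have := side_bip xy'; have := side_bip x'y.
have joinC a b : joined p q L R a b = joined p q L R b a.
  by rewrite /joined /near [(a == _) || _]orbC [jump _ _ _ _ a b || _]orbC.
move: xy' x'y; rewrite !edge_joined -sx.
case: model => -[odd_pq pqP] [[Lr Lm Rr Rm] [Ls Rs _]].
have [xp|xp] := boolP (side x).
  move=> xy' x'y; case: (boolP (side y)) => // yp _.
  case: (boolP (side y')) => // yp' _.
  by apply: (joined_min odd_pq pqP Lr Lm Rr Rm (x' := index_of x')
    (y' := index_of y')) => //; rewrite ?index_of_range // -/(side _) -sx.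
move=> xy' x'y; case: (boolP (side y)) => // yp _.
case: (boolP (side y')) => // yp' _.
(* The two classes exchange roles, [joined] being symmetric. *)
rewrite joinC; apply: (joined_min odd_pq pqP Lr Lm Rr Rm (x' := index_of y')
  (y' := index_of x')) => //; rewrite ?index_of_range // -/(side _) -?sx //;
  by rewrite joinC.
Qed.

Lemma rank_special x u w :
  bicoloured H x u -> unicoloured H x w -> rank u < rank w.
Proof.
move=> xu xw; have := side_bip (bicoloured_edge xu).
have := side_bip (unicoloured_edge xw).
have nr := unicoloured_near xw; rewrite bicolouredE in xu.
case: model => -[odd_pq pqP] [[Lr Lm Rr Rm] [Ls Rs _]].
have [xp|xp] := boolP (side x).
  case: (boolP (side w)) => // wp _; case: (boolP (side u)) => // up _.
  exact: (special_even odd_pq pqP Lr Rr Ls Rs xp up wp (index_of_range x)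
    (index_of_range u) (index_of_range w) xu nr).
case: (boolP (side w)) => // wp _; case: (boolP (side u)) => // up _.
exact: (special_odd odd_pq pqP Lr Rr Ls Rs xp up wp (index_of_range x)
  (index_of_range u) (index_of_range w) xu nr).
Qed.

Lemma special_order : irreflexive_sg H -> has_special_bipartite_min_ordering H.
Proof.
move=> irr; split=> //; pose lt : rel V := fun x y => rank x < rank y.
have linear (A : {set V}) : {in A &, forall x y, side x = side y} ->
    linear_order_on A lt.
  move=> sA; split=> [x _|y x z _ _ _|x y xA yA xy]; rewrite /lt ?ltnn //.
    exact: ltn_trans.
  rewrite -neq_ltn; apply: contraNneq xy => rxy; apply/eqP.
  exact: rank_inj (sA _ _ xA yA) rxy.
(* One relation serves as both orders, since [rank] is injective on each side. *)
exists [set x | side x], lt, lt; split.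
- split.
  + by move=> x y; rewrite !inE; apply: side_bip.
  + by apply: linear => x y; rewrite !inE => -> ->.
  + by apply: linear => x y; rewrite !inE => /negPf-> /negPf->.
  move=> x x' y y'; rewrite !inE => /negPf sx /negPf sx' _ _.
  by apply: rank_min; rewrite sx sx'.
- by move=> x u w _; apply: rank_special.
- by move=> x u w _; apply: rank_special.
Qed.

Lemma order_polynomial : list_s_hom_polynomial H.
Proof.
exact: (polynomial_list_s_hom side_bip rank_inj rank_min rank_special
  unicoloured_degree path_balanced).
Qed.

End PathOrder.

Theorem theorem9 (V : finType) (H : signed_graph V)
  (hpath : path_separable H) (hseg : segmented H) :
  has_special_bipartite_min_ordering H /\ list_s_hom_polynomial H.
Proof.
have [irr _] := hpath; have [v [path_v disj seg]] := hseg.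
have [p [q [L [R model]]]] : exists p q L R, index_model H v p q L R.
  case: seg => [right|left|[i [j [[two _ before after] [cross only]]]]].
  - by do 4 eexists; apply: right_model right.
  - by do 4 eexists; apply: left_model left.
  - by do 4 eexists; apply: left_right_model two before after cross only.
split; first exact: (special_order path_v model irr).
exact: (order_polynomial path_v model).
Qed.
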